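(* For each positive integer $n$ let \[ \rho'_n=\max_F\min_G d(F,G), \] where the maximum is over all balanced functions $F:\mathbb{F}_2^n\to\mathbb{F}_2$ (i.e. $F$ takes the values $0$ and $1$ equally often), the minimum is over all affine functions $G:\mathbb{F}_2^n\to\mathbb{F}_2$, and $d(F,G)=\#\{y\in\mathbb{F}_2^n: F(y)\neq G(y)\}$. Put $\mu'_n=2^{n/2}-\rho'_n/2^{n/2-1}$. Then $\lim_{n\to\infty}\mu'_n=1$. *)

(* Defs.v *)
From HB Require Import structures.
From mathcomp Require Import all_boot all_order all_algebra.
From mathcomp Require Import all_classical all_reals all_analysis.

Set Implicit Arguments.
Unset Strict Implicit.
Unset Printing Implicit Defensive.

Import Order.TTheory GRing.Theory Num.Theory.
Import numFieldNormedType.Exports.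

Local Open Scope ring_scope.

Definition boolean_fun (n : nat) := {ffun 'rV['F_2]_n -> 'F_2}.

Definition balanced (n : nat) (F : boolean_fun n) : bool :=
  #|[set y | F y == 0]| == #|[set y | F y == 1]|.

Definition affine (n : nat) (G : boolean_fun n) : bool :=
  [exists a : 'rV['F_2]_n, exists b : 'F_2,
    [forall y, G y == (\sum_(i < n) a 0 i * y 0 i) + b]].

Definition hdist (n : nat) (F G : boolean_fun n) : nat :=
  #|[set y | F y != G y]|.

(* The default value 2 ^ n of the minimum bounds every distance, and affine
   functions always exist, so it does not affect the minimum. *)
Definition nonlinearity (n : nat) (F : boolean_fun n) : nat :=
  \big[minn/(2 ^ n)%N]_(G : boolean_fun n | affine G) hdist F G.

(* Balanced functions exist exactly when 0 < n; the value at n = 0 is the junk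
   value 0 of an empty maximum. *)
Definition rho' (n : nat) : nat :=
  \max_(F : boolean_fun n | balanced F) nonlinearity F.

Definition mu' (R : realType) (n : nat) : R :=
  2 `^ (n%:R / 2) - (rho' n)%:R / 2 `^ (n%:R / 2 - 1).

(* Main.v *)
(** Let F : F_2^n -> F_2 and W(b) = sum_x (-1)^(F(x) + b.x). The distance of F to
    the affine functions is 2^(n-1) - max |W| / 2, so by Parseval mu'_n >= 1, and
    the claim is that, for all large n, some balanced F has
    max |W| <= (1 + eps) 2^(n/2).  Adding a bent function of two new variables
    passes from n to n + 2, so one n of each parity suffices.

    It is enough to find a function f with values in {0, 1, -1}, of sum zero, with
    few zeros and max |W| <= (1 + eps) 2^(n/2): in F(x, u) = f(x) h(u), h bent on
    2l variables, replace the rows over the zeros of f by different nontrivial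
    characters of F_2^(2l), where 4^l is just larger than the number of zeros.
    This adds at most 4^l to |W|.

    For n even, take a bent function x.y put to zero for x = 0.  For n odd, let
    K = F_(2^k) with k odd and 7^m | 2^k - 1, and let f on K^s depend only on the
    class of x_1 ... x_s in K^* / (K^* )^(7^m), vanishing on one class (a variant
    of K.-U. Schmidt's construction, with products of s coordinates instead of
    norms from an extension of degree s).  Its transform is governed by the s-th
    powers of the Gauss sums of order dividing 7^m.  As 2 generates the squares
    modulo 7^m, these sums lie in Z[pi], pi = (1 + sqrt(-7)) / 2, hence are
    - pi^a pibar^b with a + b = k.  Since pi / sqrt 2 is not a root of unity, it
    has odd powers of exponent s close to 1 or -1, with s small compared with 2^k;
    then all these s-th powers are close to the same sign times 2^(ks/2), and by
    Fourier inversion on the class group the transform of f is close to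
    2^(ks/2) times values of f. *)
Require Import Defs.
From HB Require Import structures.
From mathcomp Require Import all_boot all_order all_algebra.
From mathcomp Require Import all_fingroup all_solvable all_field all_character.
From mathcomp Require Import all_classical all_reals all_analysis.
From mathcomp Require Import zify ring lra.

Set Implicit Arguments.
Unset Strict Implicit.
Unset Printing Implicit Defensive.

Import Order.TTheory GRing.Theory Num.Theory.
Import numFieldNormedType.Exports.

Local Open Scope ring_scope.

(** * Characters of elementary abelian 2-groups *)

HB.instance Definition _ (U V : finZmodType) := Finite.on (U * V)%type.

Definition is_char (V : zmodType) (e : V -> int) :=
  e 0 = 1 /\ forall x y, e (x + y) = e x * e y.

Definition exponent2 (V : zmodType) := forall x : V, x + x = 0.

(** Self-duality of [V] through a symmetric bicharacter. Nondegeneracy is put as orthogonality, the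
    form in which sums over [b] are evaluated. *)
Definition dual_pairing (V : finZmodType) (P : V -> V -> int) :=
  [/\ forall b, is_char (P b), forall b x, P b x = P x b
    & forall x, x != 0 -> \sum_b P b x = 0].

Lemma char_sqr (V : zmodType) (e : V -> int) x :
  exponent2 V -> is_char e -> e x * e x = 1.
Proof. by move=> V2 [e0 eM]; rewrite -eM V2. Qed.

Lemma char_abs1 (V : zmodType) (e : V -> int) x :
  exponent2 V -> is_char e -> `|e x| = 1.
Proof.
move=> V2 he; apply/eqP; rewrite -(@eqrXn2 _ 2) // expr1n -normrX expr2.
by rewrite (char_sqr x V2 he) normr1.
Qed.

Lemma char_sum (V : finZmodType) (e : V -> int) a :
  is_char e -> e a != 1 -> \sum_x e x = 0.
Proof.
move=> [e0 eM] ha; have : e a * (\sum_x e x) = \sum_x e x.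
  rewrite mulr_sumr [RHS](reindex_inj (addrI a)) /=.
  by apply: eq_bigr => x _; rewrite eM.
move/eqP; rewrite -subr_eq0 -[X in _ - X]mul1r -mulrBl mulf_eq0 subr_eq0 (negbTE ha) /=.
by move/eqP.
Qed.

Lemma dual_pairing_sum (V : finZmodType) (P : V -> V -> int) x :
  dual_pairing P -> \sum_b P b x = if x == 0 then #|V|%:R else 0.
Proof.
move=> [Pc Ps P0]; case: eqP => [->|/eqP/P0//].
by under eq_bigr => b _ do rewrite (Pc b).1; rewrite sumr_const.
Qed.

(** If every coefficient [c b] vanished, so would their sum, which orthogonality evaluates to
    [#|V|]. For a [b] with [c b != 0] the character [e * P b] has nonzero sum, so it is trivial. *)
Lemma dual_pairing_char (V : finZmodType) (P : V -> V -> int) (e : V -> int) :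
  exponent2 V -> dual_pairing P -> is_char e -> exists b, e =1 P b.
Proof.
move=> V2 hP he; have [Pc Ps P0] := hP.
pose c b := \sum_x e x * P b x.
have cN0 : \sum_b c b != 0.
  rewrite /c exchange_big /=.
  under eq_bigr => x _ do rewrite -mulr_sumr (dual_pairing_sum x hP).
  rewrite (bigD1 0) //= eqxx big1 => [|x /negbTE ->]; last by rewrite mulr0.
  by rewrite he.1 addr0 mul1r pnatr_eq0 -lt0n; apply/card_gt0P; exists 0.
have [b cb] : exists b, c b != 0.
  apply/existsP; apply: contraNT cN0; rewrite negb_exists => /forallP h.
  by apply/eqP/big1 => b _; apply/eqP; rewrite -[_ == _]negbK; apply: h.
exists b => x.
have he' : is_char (fun y => e y * P b y).
  split=> [|y z]; first by rewrite he.1 (Pc b).1 mul1r.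
  by rewrite he.2 (Pc b).2 mulrACA.
have /eqP h1 : e x * P b x == 1.
  by apply: contraNT cb => hx; apply/eqP/(char_sum he' hx).
by rewrite -[e x]mulr1 -(char_sqr x V2 (Pc b)) mulrA h1 mul1r.
Qed.

Definition sg (x : 'F_2) : int := if x == 0 then 1 else -1.

Lemma F2P (x : 'F_2) : (x = 0) + (x = 1).
Proof. by case: x => [[|[|//]]] i; [left|right]; apply/val_inj. Qed.

Lemma sgD x y : sg (x + y) = sg x * sg y.
Proof. by case: (F2P x) => ->; case: (F2P y) => ->. Qed.

Lemma addF2 (x : 'F_2) : x + x = 0.
Proof. by case: (F2P x) => ->; apply/eqP. Qed.

Definition dot n (a y : 'rV['F_2]_n) := \sum_(i < n) a 0 i * y 0 i.

Definition chi n (a y : 'rV['F_2]_n) : int := sg (dot a y).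

Lemma chiC n (a y : 'rV['F_2]_n) : chi a y = chi y a.
Proof. by rewrite /chi /dot; under eq_bigr => i _ do rewrite mulrC. Qed.

Lemma chi_char n (a : 'rV['F_2]_n) : is_char (chi a).
Proof.
split=> [|x y]; rewrite /chi /dot.
  by rewrite big1 // => i _; rewrite mxE mulr0.
by rewrite -sgD -big_split /=; congr sg; apply: eq_bigr => i _; rewrite mxE mulrDr.
Qed.

Lemma rV_exponent2 n : exponent2 'rV['F_2]_n.
Proof. by move=> x; apply/rowP => i; rewrite !mxE addF2. Qed.

Lemma chi_pairing n : dual_pairing (@chi n).
Proof.
split; [exact: chi_char | exact: chiC |] => x x0.
under eq_bigr => b _ do rewrite chiC.
have [i xi] : exists i, x 0 i != 0.
  apply/existsP; apply: contraNT x0; rewrite negb_exists => /forallP h.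
  by apply/eqP/rowP => i; rewrite !mxE; apply/eqP; rewrite -[_ == _]negbK; apply: h.
apply: (@char_sum _ _ (delta_mx 0 i) (chi_char x)).
rewrite /chi /dot (bigD1 i) //= big1 => [|j ji]; last first.
  by rewrite mxE (negbTE ji) mulr0.
by rewrite mxE !eqxx mulr1 addr0 /sg (negbTE xi).
Qed.

Lemma chi_sum n (x : 'rV['F_2]_n) : \sum_b chi b x = if x == 0 then (2 ^ n)%:R else 0.
Proof.
by rewrite (dual_pairing_sum x (@chi_pairing n)) card_mx card_Fp // mul1n.
Qed.

Lemma char_rV n (e : 'rV['F_2]_n -> int) : is_char e -> exists a, e =1 chi a.
Proof. exact: dual_pairing_char (@rV_exponent2 n) (@chi_pairing n). Qed.

Lemma char_pair (U V : zmodType) (e : U * V -> int) : is_char e ->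
  [/\ is_char (fun u => e (u, 0)), is_char (fun v => e (0, v))
    & forall u v, e (u, v) = e (u, 0) * e (0, v)].
Proof.
case=> e0 eM; split.
- by split=> // x y; rewrite -eM; congr e; congr pair; rewrite addr0.
- by split=> // x y; rewrite -eM; congr e; congr pair; rewrite addr0.
- by move=> u v; rewrite -eM; congr e; congr pair; rewrite ?addr0 ?add0r.
Qed.

Lemma pair_exponent2 (U V : zmodType) :
  exponent2 U -> exponent2 V -> exponent2 (U * V)%type.
Proof. by move=> hU hV [u v]; congr pair; [exact: hU | exact: hV]. Qed.

(** Elementary abelian 2-groups of equal order are isomorphic. This carries functions built on other
    groups back to row vectors. *)
Lemma rV_iso (V : finZmodType) n : exponent2 V -> #|V| = (2 ^ n)%N ->
  exists2 g : 'rV['F_2]_n -> V, bijective g & {morph g : x y / x + y}.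
Proof.
move=> V2 cV.
have abV : (2%N.-abelem [set: V])%g.
  rewrite abelemE //; apply/andP; split.
    by apply/centsP=> x _ y _; apply: addrC.
  by apply/exponentP => x _; rewrite expgS expg1; apply: V2.
have abR : (2%N.-abelem [set: 'rV['F_2]_n])%g by apply: mx_Fp_abelem.
have : ([set: 'rV['F_2]_n] \isog [set: V])%g.
  by rewrite (isog_abelem_card _ abR) abV !cardsT cV card_mx card_Fp // mul1n eqxx.
case/isogP => g /injmP g_inj _.
exists g; last by move=> x y; apply: (@morphM _ _ _ g) => //; apply: finset.in_setT.
apply: inj_card_bij; first by move=> x y; apply: g_inj; apply: finset.in_setT.
by rewrite cV card_mx card_Fp // mul1n.
Qed.

(** * Completing partial functions *)

(** A bound on the Walsh spectrum, put in terms of abstract characters so that it passes through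
    products and isomorphisms without coordinates. *)
Definition flat (R : numDomainType) (V : finZmodType) (f : V -> int) (B : R) :=
  forall e, is_char e -> `|\sum_x f x * e x|%:~R <= B.

Lemma sum_pairE (U V : finType) (F : U * V -> int) :
  \sum_p F p = \sum_u \sum_v F (u, v).
Proof. by rewrite pair_bigA /=; apply: eq_bigr => -[]. Qed.

Lemma sum_pairM (U V : finType) (f : U -> int) (h : V -> int) :
  \sum_p f p.1 * h p.2 = (\sum_x f x) * \sum_y h y.
Proof.
rewrite sum_pairE mulr_suml; apply: eq_bigr => x _.
by rewrite mulr_sumr.
Qed.

(** A character of the product is a product of characters, so the transform factors too. *)
Lemma flat_pair (R : numDomainType) (U V : finZmodType) (f : U -> int) (h : V -> int)
    (A B : R) : flat f A -> flat h B -> flat (fun p => f p.1 * h p.2) (A * B).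
Proof.
move=> fA hB e /char_pair [e1 e2 eE].
have -> : \sum_p f p.1 * h p.2 * e p = (\sum_x f x * e (x, 0)) * \sum_y h y * e (0, y).
  rewrite sum_pairE mulr_suml; apply: eq_bigr => x _; rewrite mulr_sumr.
  by apply: eq_bigr => y _; rewrite /= eE mulrACA.
rewrite normrM intrM ler_pM ?ler0z //; first exact: fA.
exact: hB.
Qed.

Definition bent l (p : 'rV['F_2]_l * 'rV['F_2]_l) : int := chi p.1 p.2.

Lemma bent_abs1 l (p : 'rV['F_2]_l * 'rV['F_2]_l) : `|bent p| = 1.
Proof. exact: char_abs1 (@rV_exponent2 l) (chi_char _). Qed.

Lemma chi_orthogonal l (y b : 'rV['F_2]_l) :
  \sum_z chi y z * chi b z = if y == b then (2 ^ l)%:R else 0.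
Proof.
transitivity (\sum_z chi z (y + b)).
  by apply: eq_bigr => z _; rewrite (chi_char z).2 !(chiC z).
rewrite chi_sum; congr (if _ then _ else _).
by rewrite -(inj_eq (addIr b)) add0r -addrA (rV_exponent2 b) addr0.
Qed.

Lemma flat_bent (R : numDomainType) l : flat (@bent l) ((2 ^ l)%:R : R).
Proof.
move=> e /char_pair [/char_rV [a ea] /char_rV [b eb] eE].
have -> : \sum_p bent p * e p = chi a b * (2 ^ l)%:R.
  (* Row [y] of the bent function is the character [chi y], orthogonal to [chi b] unless [y = b]. *)
  rewrite sum_pairE (bigD1 b) //= [X in _ + X]big1 => [|y yb]; last first.
    rewrite (eq_bigr (fun z => chi a y * (chi y z * chi b z))) => [|z _].
      by rewrite -mulr_sumr chi_orthogonal (negbTE yb) mulr0.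
    by rewrite /bent /= eE ea eb mulrCA.
  rewrite addr0 (eq_bigr (fun z => chi a b * (chi b z * chi b z))) => [|z _].
    by rewrite -mulr_sumr chi_orthogonal eqxx.
  by rewrite /bent /= eE ea eb mulrCA.
rewrite normrM (char_abs1 _ (@rV_exponent2 l) (chi_char a)) mul1r normr_nat.
by rewrite mulrz_nat.
Qed.

Lemma chi_pair_orthogonal l (p q : 'rV['F_2]_l * 'rV['F_2]_l) :
  \sum_u chi p.1 u.1 * chi p.2 u.2 * (chi q.1 u.1 * chi q.2 u.2)
  = if p == q then (4 ^ l)%:R else 0.
Proof.
rewrite sum_pairE.
transitivity ((\sum_y chi p.1 y * chi q.1 y) * (\sum_z chi p.2 z * chi q.2 z)).
  rewrite mulr_suml; apply: eq_bigr => y _; rewrite mulr_sumr.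
  by apply: eq_bigr => z _; rewrite mulrACA.
rewrite !chi_orthogonal -pair_eqE /pair_eq.
case: eqP; case: eqP => //= _ _; rewrite ?mulr0 ?mul0r //.
by rewrite -natrM -expnMn.
Qed.

(* Maiorana-McFarland filling of the zero set of [f]: over each zero of [f] put
   a different nontrivial character, so that any character of the product
   meets at most one of them. *)
Lemma flat_fill (R : numDomainType) (V : finZmodType) (f : V -> int) (B : R) l :
  exponent2 V -> (forall x, f x != 0 -> `|f x| = 1) -> \sum_x f x = 0 -> flat f B ->
  (#|[set x | f x == 0]| < 4 ^ l)%N ->
  exists F : V * ('rV['F_2]_l * 'rV['F_2]_l) -> int,
    [/\ forall p, `|F p| = 1, \sum_p F p = 0 & flat F (B * (2 ^ l)%:R + (4 ^ l)%:R)].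
Proof.
move=> V2 f1 f0 fB cZ; set Z := [set x | f x == 0] in cZ.
pose T := ('rV['F_2]_l * 'rV['F_2]_l)%type.
have cT : #|{: T}| = (4 ^ l)%N by rewrite card_prod card_mx card_Fp // mul1n -expnMn.
(* The strict bound on [Z] leaves room to avoid the trivial character, so the filled rows sum to
   zero and balance is kept. *)
have [tau tau_inj tau0] : exists2 t : V -> T,
    {in Z &, injective t} & forall x, x \in Z -> t x != (0%R, 0%R).
  have cZ' : (#|Z| <= #|[set~ ((0%R, 0%R) : T)]|)%N by rewrite cardsC1 cT; case: (4 ^ l)%N cZ.
  pose t0 : T := (0%R, 0%R).
  pose t x := nth t0 (enum [set~ ((0%R, 0%R) : T)]) (index x (enum Z)).
  have lt x : x \in Z -> (index x (enum Z) < size (enum [set~ ((0%R, 0%R) : T)]))%N.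
    by move=> xZ; rewrite -cardE (leq_trans _ cZ') // cardE index_mem mem_enum.
  exists t => [x y xZ yZ /eqP|x xZ].
    rewrite nth_uniq ?enum_uniq ?lt // => /eqP; apply: index_inj => //;
    by rewrite mem_enum.
  by have := mem_nth t0 (lt x xZ); rewrite mem_enum !inE.
pose ch (p u : T) := chi p.1 u.1 * chi p.2 u.2.
pose F (p : V * T) := if p.1 \in Z then ch (tau p.1) p.2 else f p.1 * bent p.2.
have chn p u : `|ch p u| = 1.
  by rewrite normrM !(char_abs1 _ (@rV_exponent2 l) (chi_char _)) mulr1.
have FE (e : V * T -> int) : \sum_p F p * e p =
   \sum_p f p.1 * bent p.2 * e p + \sum_(x in Z) \sum_u ch (tau x) u * e (x, u).
  rewrite !sum_pairE [\sum_(x in Z) _]big_mkcond -big_split /=.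
  apply: eq_bigr => x _; rewrite /F /=; case: ifP => xZ; last by rewrite addr0.
  rewrite [X in X + _]big1 ?add0r // => u _.
  by move: xZ; rewrite inE => /eqP ->; rewrite !mul0r.
exists F; split.
- case=> x u; rewrite /F /=; case: ifP => // xZ.
  by rewrite normrM f1 ?bent_abs1 //; move: xZ; rewrite inE => ->.
- transitivity (\sum_p F p * 1); first by apply: eq_bigr => p _; rewrite mulr1.
  rewrite (FE (fun _ => 1)) sum_pairE.
  rewrite [X in X + _](_ : _ = (\sum_x f x) * \sum_(u : T) bent u); last first.
    rewrite mulr_suml; apply: eq_bigr => x _; rewrite mulr_sumr.
    by apply: eq_bigr => u _; rewrite mulr1.
  rewrite f0 mul0r add0r big1 // => x xZ.
  have := chi_pair_orthogonal (tau x) (0%R, 0%R); rewrite (negbTE (tau0 x xZ)).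
  apply: etrans; apply: eq_bigr => u _; congr (_ * _).
  by rewrite !(chiC 0) !(chi_char _).1 mulr1.
- move=> e he; rewrite FE.
  rewrite (le_trans (y := (`|\sum_p f p.1 * bent p.2 * e p| + (4 ^ l)%:R)%:~R)) //; last first.
    by rewrite intrD lerD ?(flat_pair fB (@flat_bent R l)) //; rewrite mulrz_nat.
  rewrite ler_int (le_trans (ler_normD _ _)) // lerD2l.
  have [e1 e2 eE] := char_pair he.
  have [/char_rV [a ea] /char_rV [b eb] eE2] := char_pair e2.
  have sE x : \sum_u ch (tau x) u * e (x, u) =
      e (x, 0) * (if tau x == (a, b) then (4 ^ l)%:R else 0).
    rewrite -chi_pair_orthogonal mulr_sumr; apply: eq_bigr => -[u v] _.
    by rewrite eE eE2 ea eb /ch mulrCA.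
  under eq_bigr => x _ do rewrite sE.
  have [x /andP[xZ /eqP tx]|no] := pickP (fun x => (x \in Z) && (tau x == (a, b))).
    rewrite (bigD1 x) //= tx eqxx big1 => [|y /andP[yZ yx]].
      by rewrite addr0 normrM (char_abs1 _ V2 e1) mul1r normr_nat.
    case: eqP => ty; last by rewrite mulr0.
    by case/eqP: yx; apply: tau_inj; rewrite // tx.
  rewrite big1 ?normr0 ?ler0n // => y yZ.
  by move: (no y); rewrite yZ /= => ->; rewrite mulr0.
Qed.

(** [c] compares the transform with [2 ^ (n/2)], the least maximum that Parseval allows. *)
Definition flat_balanced (R : rcfType) n (c : R) := exists F : 'rV['F_2]_n -> int,
  [/\ forall x, `|F x| = 1, \sum_x F x = 0 & flat F (c * Num.sqrt (2 ^+ n))].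

Lemma flat_balanced_group (R : rcfType) (V : finZmodType) n (c : R) (F : V -> int) :
  exponent2 V -> #|V| = (2 ^ n)%N -> (forall x, `|F x| = 1) -> \sum_x F x = 0 ->
  flat F (c * Num.sqrt (2 ^+ n)) -> flat_balanced n c.
Proof.
move=> V2 cV F1 F0 Fc; have [g [h gK hK] gD] := rV_iso V2 cV.
have g0 : g 0 = 0 by apply: (addrI (g 0)); rewrite -gD !addr0.
have hD : {morph h : x y / x + y}.
  by move=> x y; apply: (can_inj gK); rewrite gD !hK.
have bg : {on [pred i | true], bijective g} by exists h => x _; rewrite ?gK ?hK.
exists (F \o g); split=> [x||e [e0 eM]] /=; first exact: F1.
  by rewrite -(reindex g bg).
have := Fc (e \o h); rewrite (reindex g bg) /=.
under eq_bigr => x _ do rewrite gK.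
apply; split=> [|x y] /=; last by rewrite hD eM.
by rewrite -g0 gK.
Qed.

(** A bent factor on two variables doubles the spectrum, just as the square root doubles, so the
    ratio [c] is unchanged. *)
Lemma flat_balancedS2 (R : rcfType) n (c : R) : flat_balanced n c -> flat_balanced n.+2 c.
Proof.
case=> F [F1 F0 Fc].
apply: (@flat_balanced_group R ('rV['F_2]_n * ('rV['F_2]_1 * 'rV['F_2]_1))%type n.+2 c
  (fun p => F p.1 * bent p.2)).
- exact: pair_exponent2 (@rV_exponent2 n) (pair_exponent2 (@rV_exponent2 1) (@rV_exponent2 1)).
- by rewrite !card_prod !card_mx card_Fp // !mul1n -!expnD addn2.
- by case=> x u; rewrite normrM F1 bent_abs1.
- by rewrite sum_pairM F0 mul0r.
- rewrite (_ : c * _ = c * Num.sqrt (2 ^+ n) * (2 ^ 1)%:R).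
    exact: flat_pair Fc (@flat_bent R 1).
  rewrite -mulrA; congr (_ * _).
  rewrite (_ : 2 ^+ n.+2 = 2 ^+ n * 2 ^+ 2); last by rewrite -exprD addn2.
  rewrite sqrtrM ?exprn_ge0 //.
  by rewrite sqrtr_sqr ger0_norm.
Qed.

(** The [4 ^ l] lost in [flat_fill] is [2 ^ l * 2 ^ l]: one factor is at most [d] times the old
    square root, the other enlarges it to the new one. *)
Lemma flat_balanced_fill (R : rcfType) (V : finZmodType) (f : V -> int) n l (c d : R) :
  exponent2 V -> #|V| = (2 ^ n)%N ->
  (forall x, f x != 0 -> `|f x| = 1) -> \sum_x f x = 0 ->
  flat f (c * Num.sqrt (2 ^+ n)) ->
  (#|[set x | f x == 0]| < 4 ^ l)%N -> (2 ^ l)%:R <= d * Num.sqrt (2 ^+ n) ->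
  flat_balanced (n + l.*2) (c + d).
Proof.
move=> V2 cV f1 f0 fc cZ ld.
have [F [F1 F0 FB]] := flat_fill V2 f1 f0 fc cZ.
apply: (@flat_balanced_group R (V * ('rV['F_2]_l * 'rV['F_2]_l))%type _ _ F) => //.
- exact: pair_exponent2 V2 (pair_exponent2 (@rV_exponent2 l) (@rV_exponent2 l)).
- by rewrite !card_prod !card_mx card_Fp // !mul1n cV -!expnD addnn.
- move=> e he; apply: le_trans (FB e he) _.
  have -> : Num.sqrt (2 ^+ (n + l.*2)) = Num.sqrt (2 ^+ n) * (2 ^ l)%:R :> R.
    rewrite exprD sqrtrM ?exprn_ge0 //; congr (_ * _).
    by rewrite -muln2 exprM sqrtr_sqr ger0_norm ?exprn_ge0 // natrX.
  rewrite mulrDl mulrA lerD2l (_ : 4 ^ l = 2 ^ l * 2 ^ l)%N; last by rewrite -expnMn.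
  by rewrite natrM mulrA ler_wpM2r ?ler0n.
Qed.

(** * Gaussian periods modulo powers of 7 *)

(** The cofactor being 1 modulo 7 matters: multiplying a number congruent to 1 modulo 7 by this
    power raises its 7-adic digit at [7 ^ m.+1] by one. *)
Lemma pow8_pow7 m :
  exists k : int, (8 ^+ (7 ^ m) : int) = 1 + 7 ^+ m.+1 * (1 + 7 * k).
Proof.
elim: m => [|m [k IH]]; first by exists 0.
rewrite expnSr exprM IH (exprS 7 m.+1) !(exprS 7 m); move: (7 ^+ m : int) => z.
(* From the binomial expansion of the seventh power of [1 + 7 * z * (1 + 7 * k)]. *)
exists (k + 3 * z * (1 + 7 * k) ^+ 2 + 35 * z ^+ 2 * (1 + 7 * k) ^+ 3
  + 245 * z ^+ 3 * (1 + 7 * k) ^+ 4 + 1029 * z ^+ 4 * (1 + 7 * k) ^+ 5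
  + 2401 * z ^+ 5 * (1 + 7 * k) ^+ 6 + 2401 * z ^+ 6 * (1 + 7 * k) ^+ 7).
ring.
Qed.

(** The exponent is corrected one 7-adic digit at a time, each digit being adjusted by repeated use
    of [pow8_pow7]. *)
Lemma pow8_generates m (u : int) : (7 %| u - 1)%Z ->
  exists e (d : int), 8 ^+ e = u + 7 ^+ m * d.
Proof.
move=> /dvdzP[r hr]; have {hr} ur : u = 1 + 7 * r by rewrite mulrC -hr addrC subrK.
elim: m => [|m [e [d IH]]]; first by exists 0%N, (1 - u); rewrite !expr0; ring.
case: m IH => [_|m IH].
  by exists 0%N, (- r); rewrite ur !expr0 expr1; ring.
have step t : exists e' d' : int, exists e, e' = 8 ^+ e /\ e' = u + 7 ^+ m.+1 * (d + t%:Z + 7 * d').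
  elim: t => [|t [e' [d' [e1 [-> ht]]]]].
    by exists (8 ^+ e), 0, e; split => //; rewrite IH; congr (_ + _ * _); lia.
  have [k hk] := pow8_pow7 m.
  exists (8 ^+ (e1 + 7 ^ m)), (d' + r + k + 7 * r * k + 7 ^+ m * (d + t%:Z + 7 * d') * (1 + 7 * k)).
  exists (e1 + 7 ^ m)%N; split=> //.
  by rewrite exprD hk ht ur intS exprS; ring.
(* This many increments cancel the residue of [d] modulo 7. *)
pose t := `|(- d %% 7)%Z|%N.
have [_ [d' [e' [-> he]]]] := step t.
have tE : t%:Z = (- d %% 7)%Z by rewrite /t gez0_abs ?modz_ge0.
have := divz_eq (- d) 7; rewrite -tE; move: (- d %/ 7)%Z => q hd.
exists e', (d' - q); rewrite he (exprS 7 m.+1).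
have -> : d = - (q * 7 + t%:Z) by rewrite -hd opprK.
ring.
Qed.

Section QuadraticPeriods.
Variables (m : nat) (N : nat -> int).
Hypothesis N_mod : forall i, N i = N (i %% 7 ^ m)%N.
Hypothesis N_double : forall i, N (2 * i)%N = N i.

(** The quotient of [i %% 7] by [i] modulo [7 ^ m] is congruent to 1 modulo 7, hence a power of 8,
    and [N] is invariant under multiplication by 8. *)
Lemma period_mod7 i : (0 < m)%N -> ~~ (7 %| i)%N -> N i = N (i %% 7)%N.
Proof.
move=> m0 i7; set j := (i %% 7)%N.
have ci : coprimez i%:Z (7 ^ m)%:Z.
  by rewrite /coprimez /gcdz !absz_nat -[_ == _]/(coprime i (7 ^ m)) coprime_sym coprimeXl // prime_coprime.
have [[w w'] /= hw] := coprimezP _ _ ci.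
have hj : exists r : int, i%:Z = j%:Z + 7 * r.
  by exists (i %/ 7)%N%:Z; rewrite /j; lia.
have [r hr] := hj.
have h7 : exists z, (7 ^ m)%:Z = 7 * z.
  by case: m m0 => // n _; exists (7 ^ n)%:Z; rewrite expnS PoszM.
have [z hz] := h7.
have u1 : (7 %| j%:Z * w - 1)%Z.
  apply/dvdzP; exists (- w * r - w' * z).
  rewrite (_ : j%:Z = i%:Z - 7 * r); last by rewrite hr; ring.
  by rewrite -[X in _ - X = _]hw hz; ring.
have [e [d he]] := pow8_generates m u1.
have NE e' x : N (2 ^ e' * x)%N = N x.
  by elim: e' => [|e' IH]; rewrite ?mul1n // expnS -mulnA N_double.
rewrite -(NE (3 * e)%N i) N_mod [RHS]N_mod; congr N; apply/eqP.
rewrite -eqz_nat -[_ == _]/(_ == _ :> int).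
have : ((2 ^ (3 * e) * i)%N%:Z == j%:Z %[mod (7 ^ m)%:Z])%Z.
  rewrite eqz_mod_dvd; apply/dvdzP.
  exists (d * i%:Z - j%:Z * w').
  have h8 : (2 ^ (3 * e))%N%:Z = 8 ^+ e by rewrite expnM -[(2 ^ 3)%N]/8%N -natz natrX.
  have h7m : (7 ^ m)%N%:Z = 7 ^+ m by rewrite -natz natrX.
  rewrite PoszM h8 he h7m; move: hw; rewrite h7m => hw.
  rewrite -[X in _ - X = _]mulr1 -[X in _ - _ * X = _]hw; ring.
by rewrite -!modz_nat.
Qed.
End QuadraticPeriods.

(** The grouping separates 0, the squares 1, 2, 4 and the nonsquares 3, 5, 6 modulo 7. *)
Lemma big_nat_mul7 (V : nmodType) (F : nat -> V) n :
  \sum_(0 <= i < 7 * n) F i = \sum_(0 <= t < n) (F (7 * t)%N + (F (7 * t + 1)%N + F (7 * t + 2)%N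
     + F (7 * t + 4)%N) + (F (7 * t + 3)%N + F (7 * t + 5)%N + F (7 * t + 6)%N)).
Proof.
elim: n => [|n IH]; first by rewrite muln0 !big_geq.
rewrite mulnS addnC [RHS]big_nat_recr //= -IH.
rewrite (_ : 7 * n + 7 = (7 * n).+1.+1.+1.+1.+1.+1.+1)%N; last by rewrite !addnS addn0.
rewrite !big_nat_recr //= -!addrA; congr (_ + _).
rewrite !addnS !addn0; do 3!congr (_ + _).
by rewrite addrCA.
Qed.

Section QuadraticSums.
Variables (F : idomainType) (pi : F).
Hypothesis pi2 : pi ^+ 2 = pi - 2.

(* [z] lies in Z[pi] and has residue [r] under pi |-> 4 mod 7. *)
Let zpi_residue (z : F) (r : int) :=
  exists x y : int, z = x%:~R + y%:~R * pi /\ exists k, x + 4 * y = r + 7 * k.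

Lemma zpi_residueD z r z' r' : zpi_residue z r -> zpi_residue z' r' -> zpi_residue (z + z') (r + r').
Proof.
move=> [x [y [-> [k hk]]]] [x' [y' [-> [k' hk']]]].
exists (x + x'), (y + y'); split; first by rewrite !intrD; ring.
exists (k + k'); rewrite mulrDr addrACA hk hk'; ring.
Qed.

Lemma zpi_residueZ (a : int) z r : zpi_residue z r -> zpi_residue (a%:~R * z) (a * r).
Proof.
move=> [x [y [-> [k hk]]]]; exists (a * x), (a * y); split; first by rewrite !intrM; ring.
exists (a * k); rewrite (_ : a * x + _ = a * (x + 4 * y)); last by ring.
by rewrite hk; ring.
Qed.

(** For [z != 1] the two quadratic periods are the roots [- pi] and [pi - 1] of X^2 + X + 2. Both
    have residue 3, as do the sums at [z = 1]. *)
Lemma zpi_residue_periods (z : F) : z ^+ 7 = 1 ->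
  zpi_residue (z + z ^+ 2 + z ^+ 4) 3 /\ zpi_residue (z ^+ 3 + z ^+ 5 + z ^+ 6) 3.
Proof.
move=> z7; have [->|z1] := eqVneq z 1.
  by rewrite !expr1n; split; exists 3, 0; (split; [rewrite mul0r addr0; ring | exists 0; ring]).
have s0 : 1 + z + z ^+ 2 + z ^+ 3 + z ^+ 4 + z ^+ 5 + z ^+ 6 = 0.
  apply: (mulfI (x := z - 1)); first by rewrite subr_eq0.
  by rewrite mulr0 -[RHS](subrr 1) -[X in _ = X - _]z7; ring.
set a := z + _ + _; set b := _ + _ + z ^+ 6.
have ab : b = - 1 - a by apply/eqP; rewrite -subr_eq0; apply/eqP; rewrite -[RHS]s0 /a /b; ring.
have : (a + pi) * (a + 1 - pi) = 0.
  rewrite (_ : _ * _ = a ^+ 2 + a + pi - pi ^+ 2); last by ring.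
  rewrite pi2 (_ : a ^+ 2 + a + pi - (pi - 2) = a ^+ 2 + a + 2); last by ring.
  have e8 : z ^+ 8 = z by rewrite exprS z7 mulr1.
  rewrite /a (_ : _ + 2 = 2 * (1 + z + z ^+ 2 + z ^+ 3 + z ^+ 4 + z ^+ 5 + z ^+ 6)
     + z ^+ 8 - z); last by ring.
  by rewrite s0 e8; ring.
move/eqP; rewrite mulf_eq0 => /orP[] /eqP h.
- have ha : a = - pi by apply/eqP; rewrite -subr_eq0 opprK h.
  split; first by exists 0, (-1); rewrite ha; split; [ring | exists (-1)].
  by exists (-1), 1; rewrite ab ha; split; [ring | exists 0].
- have ha : a = pi - 1 by apply/eqP; rewrite -subr_eq0 opprB addrA h.
  split; first by exists (-1), 1; rewrite ha; split; [ring | exists 0].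
  by exists 0, (-1); rewrite ab ha; split; [ring | exists (-1)].
Qed.

(** Induction on [m]. The multiples of 7 give the same kind of sum at [z ^+ 7]; elsewhere [N]
    depends only on the index modulo 7, so a geometric sum splits off, and it vanishes unless
    [z ^+ 7 = 1]. *)
Lemma quadratic_sum m (N : nat -> int) (z : F) :
  (forall i, N i = N (i %% 7 ^ m)%N) -> (forall i, N (2 * i)%N = N i) ->
  z ^+ (7 ^ m) = 1 ->
  zpi_residue (\sum_(0 <= i < 7 ^ m) (N i)%:~R * z ^+ i) (\sum_(0 <= i < 7 ^ m) N i).
Proof.
elim: m N z => [|m IH] N z Nm Nd zm.
  by rewrite !big_nat1 expr0 mulr1; exists (N 0%N), 0; split; [rewrite mul0r addr0 | exists 0; rewrite mulr0].
pose M i := N (7 * i)%N.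
have N7 t r : ~~ (7 %| r)%N -> N (7 * t + r)%N = N (r %% 7)%N.
  move=> h; rewrite (period_mod7 Nm Nd) //; first by rewrite mulnC modnMDl.
  by rewrite dvdn_addr // dvdn_mulr.
have N2 : N 2%N = N 1%N by rewrite -(Nd 1%N).
have N4 : N 4%N = N 1%N by rewrite -N2 -(Nd 2%N).
have N6 : N 6%N = N 3%N by rewrite -(Nd 3%N).
have N5 : N 5%N = N 3%N by rewrite -(Nd 5%N) (N7 1%N 3%N).
have hM : zpi_residue (\sum_(0 <= i < 7 ^ m) (M i)%:~R * (z ^+ 7) ^+ i) (\sum_(0 <= i < 7 ^ m) M i).
  apply: IH => [i|i|]; rewrite /M.
  - by rewrite Nm expnS muln_modr.
  - by rewrite mulnCA Nd.
  - by rewrite -exprM -expnS.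
pose S := \sum_(0 <= t < 7 ^ m) (z ^+ 7) ^+ t.
have -> : \sum_(0 <= i < 7 ^ m.+1) (N i)%:~R * z ^+ i =
  \sum_(0 <= i < 7 ^ m) (M i)%:~R * (z ^+ 7) ^+ i +
  S * ((N 1%N)%:~R * (z + z ^+ 2 + z ^+ 4) + (N 3%N)%:~R * (z ^+ 3 + z ^+ 5 + z ^+ 6)).
  rewrite expnS big_nat_mul7 mulr_suml -big_split /=; apply: eq_bigr => t _.
  rewrite !N7 //= !modn_small // N2 N4 N5 N6 -exprM /M; move: (7 * t)%N => w.
  by rewrite !(exprD z w) expr1; ring.
have -> : \sum_(0 <= i < 7 ^ m.+1) N i =
  \sum_(0 <= i < 7 ^ m) M i + (7 ^ m)%N%:Z * (N 1%N * 3 + N 3%N * 3).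
  rewrite expnS big_nat_mul7 big_split big_split /= -addrA; congr (_ + _).
  under eq_bigr => t _ do rewrite !N7 //= !modn_small // N2 N4.
  rewrite sumr_const_nat subn0.
  under eq_bigr => t _ do rewrite !N7 //= !modn_small // N5 N6.
  by rewrite sumr_const_nat subn0 -mulrnDl -[LHS]mulr_natl natz; congr (_ * _); ring.
apply: zpi_residueD hM _.
have [z7|z7] := eqVneq (z ^+ 7) 1.
  have -> : S = (7 ^ m)%N%:Z%:~R.
    rewrite /S; under eq_bigr => t _ do rewrite z7 expr1n.
    by rewrite sumr_const_nat subn0 pmulrn.
  by have [h1 h3] := zpi_residue_periods z7; apply: zpi_residueZ; apply: zpi_residueD; apply: zpi_residueZ.
have -> : S = 0.
  apply: (mulfI (x := z ^+ 7 - 1)); first by rewrite subr_eq0.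
  by rewrite mulr0 /S big_mkord -subrX1 -exprM -expnS zm subrr.
rewrite mul0r; exists 0, 0; split; first by rewrite mul0r addr0.
(* [z ^+ 7 != 1] excludes [m = 0], so the residue to be matched with 0 is a multiple of 7. *)
clear IH S Nm; case: m zm => [|m] zm; first by rewrite expn1 in zm; rewrite zm eqxx in z7.
exists (- (7 ^ m)%N%:Z * (N 1%N * 3 + N 3%N * 3)).
by rewrite expnS PoszM; ring.
Qed.
End QuadraticSums.

(* Elements of norm 2^k factor by descent on k: an even norm is divisible by
   [p] or by [q]. The residue under p, q |-> 4 mod 7 keeps track of the sign. *)
Lemma norm_factor (F : comNzRingType) (p q : F) k (x y : int) : p + q = 1 -> p * q = 2 ->
  x ^+ 2 + x * y + 2 * y ^+ 2 = 2 ^+ k -> exists a b (s : bool),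
  [/\ (a + b = k)%N, x%:~R + y%:~R * p = (-1) ^+ s * p ^+ a * q ^+ b
    & exists r : int, x + 4 * y = (-1) ^+ s * 4 ^+ k + 7 * r].
Proof.
move=> pq1 pq2; elim: k x y => [|k IH] x y.
  rewrite expr0 => h.
  have y0 : y = 0 by nia.
  rewrite y0 in h *.
  have : (x == 1) || (x == -1) by nia.
  case/orP => /eqP ->; [exists 0%N, 0%N, false | exists 0%N, 0%N, true];
    (split; [by [] | rewrite !expr0 ?expr1 /=; ring | by exists 0]).
rewrite (exprS 2 k) => h.
have q1 : q = 1 - p by rewrite -pq1; ring.
(* The norm is congruent to [x * (x + y)] modulo 2. The two cases are divisibility by [p] and by
   [q]. *)
have [x' [xx|xx]] : exists x' : int, x = 2 * x' \/ x + y = 2 * x'.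
  have : (2 %| x)%Z || (2 %| x + y)%Z.
    rewrite !dvdzE -Euclid_dvdM // -abszM -(dvdzE 2).
    apply/dvdzP; exists (2 ^+ k - y ^+ 2).
    rewrite (_ : x * (x + y) = x ^+ 2 + x * y + 2 * y ^+ 2 - 2 * y ^+ 2); last by ring.
    by rewrite h; ring.
  move=> /orP[] /dvdzP[x' hx]; exists x'; [left|right]; by rewrite hx mulrC.
- have [|a [b [s [ab hz [r hr]]]]] := IH (x' + y) (- x').
    apply: (mulfI (x := 2)) => //; rewrite -h xx; ring.
  exists a.+1, b, s; split; first by rewrite addSn ab.
    2: by exists (4 * r + 2 * x'); rewrite (exprS 4 k) mulrCA -[_ * 4 ^+ k](addrK (7 * r)) -hr xx; ring.
  rewrite (exprS p) (_ : _ * (p * _) * _ = p * ((-1) ^+ s * p ^+ a * q ^+ b)); last by ring.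
  rewrite -hz xx intrM -[2%:~R]/(2 : F) -pq2 q1 intrD intrN; ring.
- have [|a [b [s [ab hz [r hr]]]]] := IH (- y) x'.
    apply: (mulfI (x := 2)) => //; rewrite -h (_ : x = 2 * x' - y); last by rewrite -xx; ring.
    ring.
  exists a, b.+1, s; split; first by rewrite addnS ab.
    2: by exists (4 * r - 2 * x' + y); rewrite (exprS 4 k) mulrCA -[_ * 4 ^+ k](addrK (7 * r)) -hr
         (_ : x = 2 * x' - y); [ring | rewrite -xx; ring].
  rewrite (exprS q) (_ : _ * (q * _) = q * ((-1) ^+ s * p ^+ a * q ^+ b)); last by ring.
  rewrite -hz (_ : x = 2 * x' - y); last by rewrite -xx; ring.
  rewrite intrB intrM -[2%:~R]/(2 : F) -pq2 q1 intrN; ring.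
Qed.

(** * Odd powers close to a sign on the unit circle *)

(** With [k] the floor of M/8, a part [4 * k] of the exponent pays for the fourth power, and a
    further [k] pays for the constant [K * 8 ^ 4]. *)
Lemma poly4_le_exp2 K : exists M0, forall M, (M0 <= M)%N -> (K * (M + 1) ^ 4 <= 2 ^ M.-1)%N.
Proof.
exists (8 * (K * 8 ^ 4 + 1))%N => M hM; set k := (M %/ 8)%N.
have k1 : (K * 8 ^ 4 + 1 <= k)%N by rewrite /k leq_divRL // mulnC.
have Mk : (M + 1 <= 8 * (k + 1))%N by rewrite /k; lia.
have kM : (4 * k + k <= M.-1)%N by rewrite /k in k1 *; lia.
apply: leq_trans (leq_pexp2l _ kM) => //.
rewrite expnD mulnC (leq_trans (n := (8 ^ 4 * 2 ^ (4 * k) * K)%N)) //.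
  rewrite leq_mul2r; apply/orP; right; apply: (leq_trans (n := ((8 * (k + 1)) ^ 4)%N)).
    by rewrite leq_exp2r.
  by rewrite expnMn leq_mul2l /= (mulnC 4) expnM leq_exp2r // addn1 ltn_expl.
rewrite mulnAC mulnC leq_mul2l; apply/orP; right.
rewrite mulnC (leq_trans _ (ltnW (ltn_expl k _))) //; lia.
Qed.

Lemma normC_Im_le (z : algC) : `|'Im z| <= `|z|.
Proof.
rewrite -(@ler_pXn2r _ 2) ?nnegrE // (normC2_Re_Im z) real_normK ?Creal_Im //.
by rewrite lerDr real_exprn_even_ge0 // Creal_Re.
Qed.

Section UnitCircle.
Implicit Types (u w z : algC).

Lemma truncn_eq_dist (x y : algC) (T : nat) : (0 < T)%N -> x \is Num.real -> y \is Num.real ->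
  -1 <= x -> -1 <= y -> Num.truncn (T%:R * (x + 1)) = Num.truncn (T%:R * (y + 1)) ->
  `|x - y| <= T%:R^-1.
Proof.
move=> T0 xr yr x1 y1 exy.
have TC : 0 < T%:R :> algC by rewrite ltr0n.
have hx : 0 <= T%:R * (x + 1) by rewrite mulr_ge0 ?ler0n // -lerBlDr sub0r.
have hy : 0 <= T%:R * (y + 1) by rewrite mulr_ge0 ?ler0n // -lerBlDr sub0r.
have /andP[xa xb] := truncn_itv hx; have /andP[ya yb] := truncn_itv hy.
rewrite exy in xa xb.
rewrite -(ler_pM2l TC) divff ?gt_eqF // -[X in X * `|_|](ger0_norm (ler0n _ T)) -normrM.
rewrite real_ler_norml ?rpredM ?rpredB ?realn //.
have -> : T%:R * (x - y) = T%:R * (x + 1) - T%:R * (y + 1) by ring.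
rewrite -natr1 in xb yb; rewrite lerBrDr addrC !lerBlDr; apply/andP; split.
  by rewrite (le_trans (ltW yb)) // lerD2r.
by rewrite (le_trans (ltW xb)) // addrC lerD2l.
Qed.

(* Dirichlet's box principle on the unit circle. *)
Lemma power_near1 u (T : nat) : `|u| = 1 -> (0 < T)%N ->
  exists2 t, (0 < t <= (2 * T + 1) ^ 2)%N & `|u ^+ t - 1| <= 2 / T%:R.
Proof.
(* [T * (x + 1)] lies in [0, 2T] for x in [-1, 1], so each coordinate has [B] cells. *)
move=> u1 T0; set B := (2 * T + 1)%N.
have un i : `|u ^+ i| = 1 by rewrite normrX u1 expr1n.
pose cell (x : algC) : nat := Num.truncn (T%:R * (x + 1)).
have cB x : x \is Num.real -> `|x| <= 1 -> (cell x < B.-1.+1)%N.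
  move=> xr; rewrite real_ler_norml // => /andP[x1 x2].
  rewrite /cell truncn_lt_nat ?mulr_ge0 ?ler0n // -?lerBlDr ?sub0r //.
  apply: (le_lt_trans (y := T%:R * 2)).
    by rewrite ler_wpM2l ?ler0n // -[2]/(1 + 1) lerD2r.
  by rewrite -natrM ltr_nat /B; lia.
have rB i : `|'Re (u ^+ i)| <= 1 by rewrite -(un i) leif_normC_Re_Creal.
have iB i : `|'Im (u ^+ i)| <= 1 by rewrite -(un i) normC_Im_le.
pose f (i : 'I_((B ^ 2).+1)) : 'I_B.-1.+1 * 'I_B.-1.+1 :=
  (Ordinal (cB _ (Creal_Re _) (rB i)), Ordinal (cB _ (Creal_Im _) (iB i))).
have : ~~ injectiveb f.
  apply/negP => /injectiveP/leq_card; rewrite card_prod !card_ord.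
  by rewrite /B; lia.
case/injectivePn => i [j ij [eR eI]].
wlog ltij : i j ij eR eI / (i < j)%N.
  move=> H; case: (ltngtP i j) => h; first exact: (H i j).
    by apply: (H j i) => //; rewrite eq_sym.
  by case/eqP: ij; apply: val_inj.
exists (j - i)%N.
  by rewrite subn_gt0 ltij /= (leq_trans (leq_subr _ _)) // -ltnS.
have -> : `|u ^+ (j - i) - 1| = `|u ^+ j - u ^+ i|.
  by rewrite -{2}(subnKC (ltnW ltij)) exprD -{2}[u ^+ i]mulr1 -mulrBr normrM un mul1r.
have h x : -1 <= 'Re (u ^+ x) /\ -1 <= 'Im (u ^+ x).
  have := rB x; have := iB x; rewrite !real_ler_norml ?Creal_Re ?Creal_Im //.
  by move=> /andP[-> _] /andP[-> _].
rewrite [u ^+ j - _]Crect (le_trans (ler_normD _ _)) // normrM normCi mul1r.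
rewrite (mulrDl 1 1) mul1r !raddfB /=.
by apply: lerD; apply: truncn_eq_dist; rewrite ?Creal_Re ?Creal_Im ?(h _).1 ?(h _).2.
Qed.

(** For p = x + iy on the unit circle, 1 - |x| <= 1 - x^2 = y^2 <= |y|. *)
Lemma norm_sub_sign (p : algC) : `|p| = 1 -> exists b : bool, `|p - (-1) ^+ b| <= 2 * `|'Im p|.
Proof.
move=> p1; set x := 'Re p; set y := 'Im p.
have xr : x \is Num.real := Creal_Re p.
have yr : y \is Num.real := Creal_Im p.
have xy : `|x| ^+ 2 + `|y| ^+ 2 = 1 by rewrite !real_normK // -normC2_Re_Im p1 expr1n.
have x1 : `|x| <= 1 by rewrite -p1 leif_normC_Re_Creal.
have y1 : `|y| <= 1 by rewrite -p1 normC_Im_le.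
have [b xb] : exists b : bool, x = (-1) ^+ b * `|x| by exists (x < 0); rewrite -realEsign.
exists b; rewrite [p]Crect -/x -/y addrAC.
rewrite (le_trans (ler_normD _ _)) // normrM normCi mul1r mulr_natl mulr2n lerD2r.
rewrite xb -{2}[(-1) ^+ b]mulr1 -mulrBr normrM normr_sign mul1r.
rewrite ler0_norm ?subr_le0 // opprB.
apply: (le_trans (y := `|y| ^+ 2)); last by rewrite expr2 ler_piMl.
rewrite -xy -[in X in _ <= X](addrK (`|x| ^+ 2) (`|y| ^+ 2)) addrC addrC.
by rewrite (addrC (`|y| ^+ 2)) xy addrC (addrC _ (- _)) lerD2r lerN2 expr2 ler_piMl.
Qed.

(* Otherwise all the imaginary parts would be larger than |z - 1| in absolute
   value, hence of the same sign, and the geometric sum, of modulus at most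
   2 / |z - 1|, would be too large. *)
Lemma small_Im w z J : `|w| = 1 -> `|z| = 1 -> z != 1 -> 2 < J%:R * `|z - 1| ^+ 2 ->
  exists2 i, (i <= J)%N & `|'Im (w * z ^+ i)| <= `|z - 1|.
Proof.
move=> w1 z1 zN1 hJ; set eta := `|z - 1|.
wlog w0 : w w1 / 0 <= 'Im w.
  move=> H; have [|wn] := real_leP (real0 _) (Creal_Im w); first exact: H.
  have [||i iJ hi] := H (- w); rewrite ?normrN ?raddfN ?oppr_ge0 ?ltW //.
  by exists i => //; move: hi; rewrite mulNr raddfN normrN.
have [/existsP[i hi]|] := boolP [exists i : 'I_J.+1, `|'Im (w * z ^+ i)| <= eta].
  by exists i => //; rewrite -ltnS.
rewrite negb_exists => /forallP big.
have e0 : 0 < eta by rewrite normr_gt0 subr_eq0.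
have big' i : (i <= J)%N -> eta < `|'Im (w * z ^+ i)|.
  move=> iJ; have := big (Ordinal (iJ : (i < J.+1)%N)); rewrite -real_ltNge ?normr_real //.
(* One multiplication by [z] moves the imaginary part by at most [eta], too little to jump from
   above [eta] to below [- eta]. *)
have pos i : (i <= J)%N -> eta < 'Im (w * z ^+ i).
  elim: i => [|i IH] iJ.
    by have := big' 0%N iJ; rewrite mulr1 ger0_norm.
  have := big' _ iJ; rewrite ger0_norm //.
  have ->: 'Im (w * z ^+ i.+1) = 'Im (w * z ^+ i) + 'Im (w * z ^+ i * (z - 1)).
    by rewrite -raddfD /=; congr ('Im _); rewrite exprSr; ring.
  have : `|'Im (w * z ^+ i * (z - 1))| <= eta.
    by rewrite (le_trans (normC_Im_le _)) // !normrM w1 normrX z1 expr1n !mul1r.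
  rewrite real_ler_norml ?Creal_Im // => /andP[h _].
  by rewrite -lerBlDr sub0r (le_trans _ (ltW (IH (ltnW iJ)))) // lerNl.
have S1 : J%:R * eta <= 'Im (\sum_(i < J) w * z ^+ i).
  rewrite raddf_sum /= -[J in J%:R]card_ord mulr_natl -sumr_const.
  by apply: ler_sum => i _; apply/ltW/pos/ltnW.
have S2 : eta * 'Im (\sum_(i < J) w * z ^+ i) <= 2.
  apply: (le_trans (y := eta * `|\sum_(i < J) w * z ^+ i|)).
    apply: ler_wpM2l; first exact: ltW.
    by apply: le_trans (normC_Im_le _); apply: real_ler_norm; apply: Creal_Im.
  rewrite -normrM -mulr_sumr mulrCA -subrX1 normrM w1 mul1r.
  by rewrite (le_trans (ler_normB _ _)) // normrX z1 expr1n normr1.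
have : J%:R * eta ^+ 2 <= 2.
  by rewrite (le_trans _ S2) // expr2 mulrA mulrC ler_wpM2l // ltW.
by rewrite real_leNgt ?hJ // rpredM ?realn ?rpredX ?normr_real.
Qed.

(** A power [z] of [w ^+ 2] is close to 1 but different from it, and some [w * z ^+ i], an odd power
    of [w], is nearly real. Its exponent is polynomial in the inverse of [eta], while [2 ^ j] is
    exponential in it. *)
Lemma odd_power_near_sign w : `|w| = 1 -> (forall t, (0 < t)%N -> (w ^+ 2) ^+ t != 1) ->
  forall A : nat, (0 < A)%N -> exists s j (b : bool),
    [/\ odd s, (A * s <= 2 ^ j)%N & `|w ^+ s - (-1) ^+ b| <= (A * j.+1)%:R^-1].
Proof.
move=> w1 wtors A A0.
(* The constant comes from [s = 1 + 2 * t * i] with [t <= (13 * A * (M + 1)) ^ 2] and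
   [i <= 2 * (3 * A * (M + 1)) ^ 2]. *)
have [M0 hM0] := poly4_le_exp2 (A * (1 + 4 * 169 * 9 * A ^ 4)).
(* Large enough to force [M0 < M] below. *)
pose T := (8 * A * (M0 + 4))%N.
have T0 : (0 < T)%N by rewrite /T !muln_gt0 A0 addn_gt0 orbT.
have u1 : `|w ^+ 2| = 1 by rewrite normrX w1 expr1n.
have [t /andP[t0 tT] ht] := power_near1 u1 T0.
set z := (w ^+ 2) ^+ t in ht; set eta := `|z - 1| in ht.
have z1 : `|z| = 1 by rewrite /z normrX u1 expr1n.
have zN1 : z != 1 by apply: wtors.
have e0 : 0 < eta by rewrite normr_gt0 subr_eq0.
pose N := Num.truncn eta^-1.
have /andP[Na Nb] : N%:R <= eta^-1 < N.+1%:R by apply: truncn_itv; rewrite invr_ge0 ltW.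
have TN : (T < 2 * N.+1)%N.
  rewrite -(ltr_nat algC); apply: (le_lt_trans (y := 2 * eta^-1)); last first.
    by rewrite natrM ltr_pM2l ?ltr0n.
  by rewrite ler_pdivlMr // mulrC -ler_pdivlMr ?ltr0n.
have N0 : (0 < N)%N by rewrite /T in TN; nia.
(* [N.+1 * eta > 1], so [2 * N.+1 ^ 2] steps suffice for [small_Im]. *)
have hJ : 2 < (2 * N.+1 ^ 2)%:R * eta ^+ 2.
  rewrite natrM natrX -mulrA -{1}[2]mulr1 ltr_pM2l ?ltr0n // -exprMn.
  have : 1 < N.+1%:R * eta by rewrite -ltr_pdivrMr // mul1r.
  by move=> h; rewrite exprn_egt1.
have [i iJ hi] := small_Im w1 z1 zN1 hJ.
have pE : w * z ^+ i = w ^+ (1 + 2 * t * i) by rewrite exprD expr1 /z -!exprM mulnA.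
have p1 : `|w * z ^+ i| = 1 by rewrite normrM w1 mul1r normrX z1 expr1n.
have [b hb] := norm_sub_sign p1.
(* Chosen so that the error [2 * eta <= 2 / N] is at most [1 / (A * M)]; then [j] is [M.-1]. *)
pose M := (N %/ (2 * A))%N.
have NM : (N < 2 * A * M.+1)%N by rewrite mulnC ltn_ceil // muln_gt0.
have M1 : (M0 + 1 <= M)%N.
  rewrite /M leq_divRL ?muln_gt0 //; rewrite /T in TN; nia.
have MN : (2 * A * M <= N)%N by rewrite mulnC leq_trunc_div.
exists (1 + 2 * t * i)%N, M.-1, b; split.
- by rewrite -mulnA mul2n /= odd_double.
- have /hM0 := leq_trans (leq_addr 1 M0) M1; apply: leq_trans.
  rewrite -[X in (_ <= X)%N]mulnA leq_mul2l; apply/orP; right.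
  have h1 : (t * i <= (2 * T + 1) ^ 2 * (2 * N.+1 ^ 2))%N by apply: leq_mul.
  have h2 : (2 * T + 1 <= 13 * A * (M + 1))%N by nia.
  have h3 : (N.+1 <= 3 * A * (M + 1))%N by nia.
  have h4 : ((2 * T + 1) ^ 2 <= (13 * A * (M + 1)) ^ 2)%N by rewrite leq_exp2r.
  have h5 : (N.+1 ^ 2 <= (3 * A * (M + 1)) ^ 2)%N by rewrite leq_exp2r.
  have h6 : (t * i <= (13 * A * (M + 1)) ^ 2 * (2 * (3 * A * (M + 1)) ^ 2))%N.
    by rewrite (leq_trans h1) // leq_mul // leq_mul2l h5 orbT.
  rewrite (_ : (_ * (_ * _))%N = (2 * 169 * 9 * (A ^ 4 * (M + 1) ^ 4))%N) in h6; last by ring.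
  have h7 : (0 < (M + 1) ^ 4)%N by rewrite expn_gt0 addn1.
  rewrite mulnDl mul1n -mulnA leq_add //.
  rewrite (leq_trans (leq_mul (leqnn 2) h6)) //.
  move: (A ^ 4 )%N ((M + 1) ^ 4)%N => a c; nia.
- rewrite -pE (le_trans hb) // (le_trans (y := 2 * eta)) ?ler_pM2l ?ltr0n //.
  rewrite prednK; last by rewrite (leq_trans _ M1) // addn1.
  have M0' : (0 < M)%N by rewrite (leq_trans _ M1) // addn1.
  rewrite -[X in X <= _]invrK lef_pV2 ?posrE ?invr_gt0 ?mulr_gt0 ?ltr0n ?muln_gt0 ?A0 //.
  rewrite invfM mulrC ler_pdivlMr ?ltr0n // (le_trans _ Na) //.
  by rewrite -natrM ler_nat mulnC mulnA.
Qed.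

End UnitCircle.

(** * Gauss sums in characteristic 2 *)

(* psi = (-1)^Tr, where Tr is the absolute trace. *)
Lemma finField2_char k : (0 < k)%N -> exists (K : finFieldType) (psi : K -> int),
  [/\ #|K| = (2 ^ k)%N, exponent2 K, is_char psi, forall x, psi (x ^+ 2) = psi x
    & exists a, psi a != 1].
Proof.
move=> k0; have [K chK cK] := pPrimePowerField (isT : prime 2) k0.
have K2 : exponent2 K by move=> x; rewrite -mulr2n -mulr_natr (pcharf0 chK) mulr0.
pose Tr (x : K) := \sum_(i < k) x ^+ (2 ^ i).
have TrD x y : Tr (x + y) = Tr x + Tr y.
  rewrite -big_split /=; apply: eq_bigr => i _; rewrite exprDn_pchar //.
  by rewrite (eq_pnat _ (pcharf_eq chK)) pnatX.
have sqrD (x y : K) : (x + y) ^+ 2 = x ^+ 2 + y ^+ 2.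
  by rewrite sqrrD (_ : _ *+ 2 = 0) ?addr0 // mulr2n K2.
have Tr2 x : Tr (x ^+ 2) = Tr x.
  rewrite /Tr -(prednK k0) big_ord_recr big_ord_recl /= -exprM -expnS (prednK k0) -cK.
  rewrite expf_card addrC expr1; congr (_ + _); apply: eq_bigr => i _.
  by rewrite -exprM -expnS.
have Tr_sqr x : (Tr x) ^+ 2 = Tr x.
  rewrite -{2}Tr2 /Tr; elim: (k) => [|n IH]; first by rewrite !big_ord0 expr0n.
  by rewrite !big_ord_recr sqrD IH -!exprM mulnC.
have Tr01 x : (Tr x == 0) || (Tr x == 1).
  by rewrite -[_ == 1]subr_eq0 -mulf_eq0 mulrBr mulr1 -expr2 Tr_sqr subrr.
exists K, (fun x => if Tr x == 0 then 1 else -1); split=> //.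
- have Tr0 : Tr 0 = 0 by rewrite /Tr big1 // => i _; rewrite expr0n expn_eq0.
  split=> [|x y]; first by rewrite Tr0 eqxx.
  rewrite TrD; case/orP: (Tr01 x) => /eqP ->; case/orP: (Tr01 y) => /eqP ->;
  by rewrite ?addr0 ?add0r ?K2 ?eqxx ?oner_eq0.
- by move=> x; rewrite Tr2.
- suff /existsP[a ha] : [exists a, Tr a != 0] by exists a; rewrite (negbTE ha).
  apply: contraT; rewrite negb_exists => /forallP h; exfalso.
  (* A trace vanishing everywhere would be a nonzero polynomial of degree at most [2 ^ k.-1] with
     [2 ^ k] roots. *)
  pose p : {poly K} := \sum_(i < k) 'X^(2 ^ i).
  have pN0 : p != 0.
    apply/eqP => /(congr1 (fun q : {poly K} => q`_1)); rewrite coef0 coef_sum.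
    rewrite -(prednK k0) big_ord_recl coefXn eqxx big1 => [|i _].
      by rewrite addr0 => /eqP; rewrite oner_eq0.
    by rewrite coefXn (_ : _ == _ = false) // lift0 expnS; lia.
  have sp : (size p <= (2 ^ k.-1).+1)%N.
    apply: (leq_trans (size_sum _ _ _)); apply/bigmax_leqP => i _.
    by rewrite size_polyXn ltnS leq_pexp2l // -ltnS (prednK k0).
  have rp : all (root p) (enum K).
    apply/allP => x _; rewrite rootE horner_sum.
    under eq_bigr => i _ do rewrite hornerXn.
    by have := h x; rewrite negbK.
  have := leq_trans (max_poly_roots pN0 rp (enum_uniq _)) sp.
  by rewrite -cardE cK ltnS leqNgt ltn_exp2l // prednK // leqnn.
Qed.

(** A discrete logarithm with natural number values, which can then be read modulo any divisor of
    [#|K|.-1]. *)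
Lemma finField_log (K : finFieldType) : exists L : K -> nat,
  (forall x y : K, x != 0 -> y != 0 -> (L (x * y)%R = L x + L y %[mod #|K|.-1])%N)
  /\ exists2 g, g != 0 & (L g = 1 %[mod #|K|.-1])%N.
Proof.
set n := #|K|.-1.
have K1 : (1 < #|K|)%N by apply: finNzRing_gt1.
have n0 : (0 < n)%N by rewrite /n -subn1 subn_gt0.
have fn x : x != 0 :> K -> x ^+ n = 1.
  move=> x0; apply: (mulfI x0).
  by rewrite mulr1 -exprS prednK ?expf_card // ltnW.
have /hasP[g _ gp] : has n.-primitive_root (enum [pred x : K | x != 0]).
  apply: has_prim_root => //; last by rewrite -cardE -[[pred x | _]]/(predC1 0) cardC1.
    by apply/allP => x; rewrite mem_enum unity_rootE => /fn ->.
  exact: enum_uniq.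
have g0 : g != 0.
  apply: contraTneq gp => ->.
  rewrite -(prednK n0); apply/negP => /prim_expr_order /eqP.
  by rewrite exprS mul0r eq_sym oner_eq0.
pose L x := odflt 0%N (omap (@nat_of_ord n) [pick i : 'I_n | g ^+ i == x]).
have LK x : x != 0 -> g ^+ L x = x.
  move=> x0; rewrite /L; case: pickP => [i /eqP //|no].
  have [i hi] := prim_rootP gp (fn x x0).
  by have := no i; rewrite hi eqxx.
exists L; split=> [x y x0 y0|].
  by apply/eqP; rewrite -(eq_prim_root_expr gp) exprD !LK // mulf_neq0.
by exists g => //; apply/eqP; rewrite -(eq_prim_root_expr gp) LK // expr1.
Qed.

Section GaussSums.
Variables (K : finFieldType) (psi : K -> int) (L : K -> nat) (v : nat) (g : K).
Hypothesis K2 : exponent2 K.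
Hypothesis psi_char : is_char psi.
Hypothesis psi_sqr : forall x, psi (x ^+ 2) = psi x.
Hypothesis psi_ntriv : exists a, psi a != 1.
Hypothesis LM : forall x y, x != 0 -> y != 0 -> (L (x * y)%R = L x + L y %[mod v])%N.
Hypothesis g0 : g != 0.
Hypothesis Lg : (L g = 1 %[mod v])%N.
Hypothesis v0 : (0 < v)%N.

(** For [z ^+ v = 1], the multiplicative character sending [g] to [z]; its value at 0 is 0 even for
    [z = 1]. *)
Definition mult_char (z : algC) (x : K) : algC := if x == 0 then 0 else z ^+ L x.
Definition gauss (z : algC) : algC := \sum_x mult_char z x * (psi x)%:~R.

Lemma psi_mul_sum x : x != 0 -> \sum_b psi (b * x) = 0.
Proof.
have [a ha] := psi_ntriv => x0.
apply: (@char_sum _ (fun b => psi (b * x)) (a / x)); last by rewrite divfK.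
by split=> [|b c]; rewrite ?mul0r ?mulrDl ?psi_char.1 ?psi_char.2.
Qed.

Section Character.
Variable z : algC.
Hypothesis zv : z ^+ v = 1.

Lemma exp_modv i j : (i = j %[mod v])%N -> z ^+ i = z ^+ j.
Proof. by move=> h; rewrite -(expr_mod i zv) h expr_mod. Qed.

Lemma unity_root_norm : `|z| = 1.
Proof. by apply/eqP; rewrite -(@pexpr_eq1 _ _ v) ?normr_ge0 // -normrX zv normr1. Qed.

Lemma mult_charM x y : mult_char z (x * y) = mult_char z x * mult_char z y.
Proof.
rewrite /mult_char mulf_eq0; case: eqP => [|/eqP x0]; first by rewrite mul0r.
case: eqP => [|/eqP y0] /=; first by rewrite mulr0.
by rewrite -exprD; apply: exp_modv; apply: LM.
Qed.

Lemma mult_char_norm x : x != 0 -> `|mult_char z x| = 1.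
Proof. by move=> x0; rewrite /mult_char (negbTE x0) normrX unity_root_norm expr1n. Qed.

Lemma mult_char1 : mult_char z 1 = 1.
Proof.
have := mult_charM 1 1; rewrite mulr1 => /eqP; rewrite -subr_eq0 -{1}[mult_char z 1]mulr1 -mulrBr mulf_eq0.
by rewrite -normr_eq0 mult_char_norm ?oner_eq0 //= subr_eq0 => /eqP.
Qed.

Lemma mult_char_inv x : x != 0 -> mult_char z x^-1 = (mult_char z x)^*.
Proof.
move=> x0; apply: (mulfI (x := mult_char z x)); first by rewrite -normr_eq0 mult_char_norm ?oner_eq0.
by rewrite -mult_charM divff // mult_char1 -normCK mult_char_norm // expr1n.
Qed.

Hypothesis z1 : z != 1.

Lemma mult_char_sum : \sum_x mult_char z x = 0.
Proof.
have : mult_char z g * (\sum_x mult_char z x) = \sum_x mult_char z x.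
  rewrite mulr_sumr [RHS](reindex_inj (mulfI g0)) /=.
  by apply: eq_bigr => x _; rewrite mult_charM.
move/eqP; rewrite -subr_eq0 -[X in _ - X]mul1r -mulrBl mulf_eq0 subr_eq0.
by rewrite {1}/mult_char (negbTE g0) (exp_modv Lg) expr1 (negbTE z1) /= => /eqP.
Qed.

(** Substitute x / b for x. At [b = 0] both sides vanish, the left one because [z != 1]. *)
Lemma gauss_twist b : \sum_x mult_char z x * (psi (b * x))%:~R = (mult_char z b)^* * gauss z.
Proof.
have [->|b0] := eqVneq b 0.
  rewrite {2}/mult_char eqxx conjC0 mul0r -[RHS]mult_char_sum; apply: eq_bigr => x _.
  by rewrite mul0r psi_char.1 mulr1.
rewrite (reindex_inj (mulfI (invr_neq0 b0))) /= mulr_sumr.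
by apply: eq_bigr => x _; rewrite mulVKf // mult_charM mult_char_inv // mulrA.
Qed.

(** Parseval for the additive transform [W] of the character: by [gauss_twist] all its values at
    [b != 0] have the modulus of the Gauss sum. *)
Lemma gauss_norm : `|gauss z| ^+ 2 = #|K|%:R.
Proof.
pose W b := \sum_x mult_char z x * (psi (b * x))%:~R.
have Wb b : `|W b| ^+ 2 = (b != 0)%:R * `|gauss z| ^+ 2.
  rewrite /W gauss_twist normrM norm_conjC exprMn; congr (_ * _).
  have [->|b0] := eqVneq b 0; first by rewrite /mult_char eqxx normr0 expr0n.
  by rewrite mult_char_norm // expr1n.
have : \sum_b `|W b| ^+ 2 = #|K|%:R * \sum_(x : K) (x != 0)%:R.
  transitivity (\sum_b \sum_x \sum_y mult_char z x * (mult_char z y)^* * (psi (b * (x + y)))%:~R).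
    apply: eq_bigr => b _; rewrite normCK rmorph_sum mulr_suml.
    apply: eq_bigr => x _; rewrite mulr_sumr; apply: eq_bigr => y _ /=.
    rewrite [(_ * _)^*]rmorphM /= [(_%:~R)^*]conj_Creal ?realz // mulrACA -intrM mulrDr.
    by rewrite psi_char.2.
  rewrite exchange_big mulr_sumr /=; apply: eq_bigr => x _.
  rewrite exchange_big (bigD1 x) //= [X in _ + X]big1 => [|y yx].
    rewrite addr0 -mulr_sumr -normCK.
    under eq_bigr => b _ do rewrite K2 mulr0 psi_char.1.
    rewrite sumr_const mulrC; congr (_ * _).
    have [->|x0] := eqVneq x 0; first by rewrite /mult_char eqxx normr0 expr0n.
    by rewrite mult_char_norm // expr1n.
  rewrite -mulr_sumr -rmorph_sum psi_mul_sum ?rmorph0 ?mulr0 //.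
  by rewrite -(inj_eq (addIr y)) add0r -addrA K2 addr0 eq_sym.
under eq_bigr => b _ do rewrite Wb.
rewrite -mulr_suml mulrC; apply: mulIf.
rewrite (bigD1 1) //= oner_eq0 paddr_eq0 ?ler01 ?sumr_ge0 //.
  by rewrite oner_eq0.
Qed.

End Character.

(** The Gaussian periods, integers because [psi] is a sign. *)
Definition class_sum i := \sum_(x | (x != 0) && (L x == i %[mod v])%N) psi x.

Lemma class_sum_mod i : class_sum i = class_sum (i %% v)%N.
Proof. by apply: eq_bigl => x; rewrite modn_mod. Qed.

Lemma gauss_class z : z ^+ v = 1 ->
  gauss z = \sum_(0 <= i < v) (class_sum i)%:~R * z ^+ i.
Proof.
move=> zv; rewrite big_mkord /gauss.
transitivity (\sum_x \sum_(i < v | (x != 0) && (L x == i %[mod v])%N) (psi x)%:~R * z ^+ i).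
  apply: eq_bigr => x _; rewrite /mult_char; have [x0|x0] := eqVneq x 0.
    by rewrite mul0r big_pred0.
  rewrite (big_pred1 (Ordinal (ltn_pmod (L x) v0))) => [|i]; last first.
    by rewrite /= -val_eqE /= eq_sym (modn_small (ltn_ord i)).
  by rewrite mulrC; congr (_ * _); apply: exp_modv => //=; rewrite modn_mod.
rewrite (exchange_big_dep predT) //=; apply: eq_bigr => i _.
by rewrite /class_sum rmorph_sum mulr_suml.
Qed.

Lemma class_sum_total : \sum_(0 <= i < v) class_sum i = -1.
Proof.
have h : \sum_(x | x != 0) psi x = -1.
  have := psi_mul_sum (oner_neq0 K).
  under eq_bigr => b _ do rewrite mulr1.
  by rewrite (bigD1 0) //= psi_char.1 => /eqP; rewrite addrC addr_eq0 => /eqP.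
rewrite big_mkord -h /class_sum.
rewrite (exchange_big_dep (fun x : K => x != 0)) /=; last by move=> i x _ /andP[].
apply: eq_bigr => x x0.
rewrite (big_pred1 (Ordinal (ltn_pmod (L x) v0))) // => i.
by rewrite x0 /= -val_eqE /= eq_sym (modn_small (ltn_ord i)).
Qed.

(** Squaring permutes [K], preserves [psi] and doubles logarithms. *)
Lemma class_sum_double i : odd v -> class_sum (2 * i)%N = class_sum i.
Proof.
move=> vodd; have sqr_inj : injective (fun x : K => x ^+ 2).
  move=> x y /eqP; rewrite -subr_eq0 => h; apply/eqP; rewrite -subr_eq0.
  rewrite -sqrf_eq0 sqrrB.
  have N (a : K) : - a = a by apply: (addrI a); rewrite subrr K2.
  by rewrite mulr2n K2 subr0 -[y ^+ 2]N.
rewrite /class_sum (reindex_inj sqr_inj) /=; apply: eq_big => [x|x _]; last exact: psi_sqr.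
rewrite expf_eq0 /=; have [//|x0 /=] := eqVneq x 0.
rewrite expr2 LM // addnn -mul2n.
(* [v.+1./2] inverts 2 modulo the odd [v]. *)
have halve k : (v.+1./2 * (2 * k) = k %[mod v])%N.
  by rewrite mulnA muln2 halfK /= vodd subn0 mulSn addnC mulnC modnMDl.
apply/eqP/eqP => h; last by rewrite -modnMmr h modnMmr.
by rewrite -(halve (L x)) -(halve i) -modnMmr h modnMmr.
Qed.

End GaussSums.

(** * Gauss sums of order a power of 7 *)

Definition pi7 : algC := (1 + 'i * sqrtC 7) / 2.

Lemma pi7_conj : pi7^* = (1 - 'i * sqrtC 7) / 2.
Proof.
have -> : pi7 = 2^-1 + 'i * (sqrtC 7 / 2) by rewrite /pi7; field.
rewrite conjC_rect; first by field.
  by rewrite ger0_real // invr_ge0 ler0n.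
by rewrite ger0_real // divr_ge0 ?sqrtC_ge0 ?ler0n.
Qed.

Lemma pi7_sum : pi7 + pi7^* = 1.
Proof. by rewrite pi7_conj /pi7; field. Qed.

Lemma pi7_prod : pi7 * pi7^* = 2.
Proof.
have -> : pi7 * pi7^* = (1 - 'i ^+ 2 * sqrtC 7 ^+ 2) / 4.
  by rewrite pi7_conj /pi7; field.
by rewrite sqrCi sqrtCK; field.
Qed.

Lemma pi7_sqr : pi7 ^+ 2 = pi7 - 2.
Proof. by rewrite -pi7_prod -[X in _ = X - _]mulr1 -mulrBr -pi7_sum addrK expr2. Qed.

Lemma pi7_Nreal : pi7 != pi7^*.
Proof.
apply/eqP => h; have h1 := pi7_sum; rewrite -h in h1.
have h2 := pi7_prod; rewrite -h in h2.
have : (2 * pi7) ^+ 2 = 8 by rewrite exprMn [pi7 ^+ 2]expr2 h2; ring.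
rewrite mulr_natl mulr2n h1 expr1n => /eqP.
by rewrite -[1]/(1%:R) eqr_nat.
Qed.

(** Modulo 2 [pi7] is idempotent, so its powers keep an odd coefficient at [pi7] and are never
    real. *)
Lemma pi7_pow (t : nat) :
  exists x y : int, pi7 ^+ t.+1 = (2 * x)%:~R + (2 * y + 1)%:~R * pi7.
Proof.
elim: t => [|t [x [y IH]]]; first by exists 0, 0; rewrite expr1; ring.
exists (- (2 * y + 1)), (x + y); rewrite exprSr IH mulrDl -mulrA -expr2 pi7_sqr.
by rewrite !(intrD, intrM, intrN); ring.
Qed.

Lemma conj_intD (x y : int) (p : algC) :
  (x%:~R + y%:~R * p)^* = x%:~R + y%:~R * p^*.
Proof.
by rewrite [LHS]rmorphD [X in _ + X]rmorphM /= [x%:~R^*]conj_Creal ?[y%:~R^*]conj_Creal ?realz.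
Qed.

Definition w7 : algC := pi7 / sqrtC 2.

Lemma sqrtC2_gt0 : 0 < sqrtC 2 :> algC.
Proof. by rewrite sqrtC_gt0 ltr0n. Qed.

Lemma w7_norm : `|w7| = 1.
Proof.
apply/eqP; rewrite -(@pexpr_eq1 _ _ 2) // normCK /w7 rmorphM fmorphV /=.
rewrite [(sqrtC 2)^*]conj_Creal ?gtr0_real ?sqrtC2_gt0 //.
by rewrite mulrACA pi7_prod -invfM -expr2 sqrtCK divff // pnatr_eq0.
Qed.

(** Otherwise [pi7 ^+ (2 * t)] would be 2^t, the product of [pi7 ^+ t] and its conjugate, making
    [pi7 ^+ t] real. *)
Lemma w7_nontorsion t : (0 < t)%N -> (w7 ^+ 2) ^+ t != 1.
Proof.
case: t => // t _; apply/eqP => h.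
have h1 : pi7 ^+ t.+1 = (pi7^*) ^+ t.+1.
  have p0 : pi7 ^+ t.+1 != 0.
    rewrite expf_eq0 /=; apply/eqP => p0; have := pi7_prod.
    by rewrite p0 mul0r => /eqP; rewrite eq_sym pnatr_eq0.
  apply: (mulfI p0); rewrite -[RHS]exprMn pi7_prod -expr2 -exprM mulnC exprM.
  move: h; rewrite /w7 expr_div_n sqrtCK expr_div_n => /(canRL (mulfVK _)) ->.
    by rewrite mul1r.
  by rewrite expf_neq0 // pnatr_eq0.
have [x [y hxy]] := pi7_pow t.
have : (2 * y + 1)%:~R * (pi7 - pi7^*) = 0.
  have := h1; rewrite -rmorphXn /= hxy conj_intD.
  by move=> /addrI e; rewrite mulrBr e subrr.
move/eqP; rewrite mulf_eq0 subr_eq0 (negbTE pi7_Nreal) orbF intr_eq0; lia.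
Qed.

Lemma near_mul (x y a b : algC) : `|y| = 1 -> `|a| = 1 ->
  `|x * y - a * b| <= `|x - a| + `|y - b|.
Proof.
move=> y1 a1; have -> : x * y - a * b = (x - a) * y + a * (y - b) by ring.
by rewrite (le_trans (ler_normD _ _)) // !normrM y1 a1 mulr1 mul1r.
Qed.

Lemma near_exp (x a : algC) n : `|x| = 1 -> `|a| = 1 -> `|x ^+ n - a ^+ n| <= n%:R * `|x - a|.
Proof.
move=> x1 a1; elim: n => [|n IH]; first by rewrite !expr0 subrr normr0 mul0r.
rewrite !exprSr (le_trans (near_mul _ _ x1 _)) ?normrX ?a1 ?expr1n //.
by rewrite -natr1 mulrDl mul1r lerD2r.
Qed.

Section SevenPower.
Variables (K : finFieldType) (psi : K -> int) (L : K -> nat) (m k : nat) (g : K).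
Local Notation v := (7 ^ m)%N.
Hypothesis K2 : exponent2 K.
Hypothesis psi_char : is_char psi.
Hypothesis psi_sqr : forall x, psi (x ^+ 2) = psi x.
Hypothesis psi_ntriv : exists a, psi a != 1.
Hypothesis LM : forall x y, x != 0 -> y != 0 -> (L (x * y)%R = L x + L y %[mod v])%N.
Hypothesis g0 : g != 0.
Hypothesis Lg : (L g = 1 %[mod v])%N.
Hypothesis cK : #|K| = (2 ^ (3 * k))%N.

(** [quadratic_sum] places the Gauss sum in Z[pi7], and its norm [2 ^ (3 * k)] determines the
    factors up to sign. The class sums total -1 while 4^3 is 1 modulo 7, so the sign is minus. *)
Lemma gauss_pow7 z : z ^+ v = 1 -> z != 1 -> exists a b,
  (a + b = 3 * k)%N /\ gauss psi L z = - (pi7 ^+ a * (pi7^*) ^+ b).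
Proof.
move=> zv z1; have v0 : (0 < v)%N by rewrite expn_gt0.
have vodd : odd v by rewrite oddX orbT.
have [x [y [hz [r hr]]]] := quadratic_sum pi7_sqr
  (@class_sum_mod K psi L v) (fun i => class_sum_double K2 psi_sqr LM i vodd) zv.
rewrite -(gauss_class psi L v0 zv) in hz.
rewrite (class_sum_total L psi_char psi_ntriv v0) in hr.
have hN : x ^+ 2 + x * y + 2 * y ^+ 2 = 2 ^+ (3 * k).
  apply: (@intr_inj algC); rewrite rmorphXn /= -[2%:~R]/(2 : algC) -natrX -cK.
  rewrite -(gauss_norm K2 psi_char psi_ntriv LM g0 Lg v0 zv z1) hz normCK.
  rewrite conj_intD; transitivity (x%:~R ^+ 2 + x%:~R * y%:~R * (pi7 + pi7^*) 
    + (pi7 * pi7^*) * y%:~R ^+ 2 : algC); last by ring.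
  by rewrite pi7_sum pi7_prod !(intrD, intrM, rmorphXn) /= mulr1.
have [a [b [sb [ab hs [r' hr']]]]] := norm_factor pi7_sum pi7_prod hN.
exists a, b; split=> //; rewrite hz hs.
case: sb hs hr' => hs hr'; first by rewrite expr1 mulN1r mulNr.
have [q hq] : exists q : int, 4 ^+ (3 * k) = 1 + 7 * q.
  elim: (k) => [|n [q IH]]; first by exists 0; rewrite muln0.
  by exists (64 * q + 9); rewrite mulnS exprD IH; ring.
by exfalso; move: hr'; rewrite hr hq expr0; lia.
Qed.
End SevenPower.

(** * Flat partial functions *)

(** One class gets 0, and for odd [v] the remaining classes below [v] alternate in sign and
    cancel. *)
Definition altsign (i : nat) : int := if i == 0%N then 0 else (-1) ^+ i.

Lemma altsign_abs i : altsign i != 0 -> `|altsign i| = 1.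
Proof.
rewrite /altsign; case: (i == 0%N) => [|_]; first by rewrite eqxx.
by rewrite normrX normrN1 expr1n.
Qed.

Lemma altsign_le1 i : `|altsign i| <= 1.
Proof. by have [->|/altsign_abs ->] := eqVneq (altsign i) 0. Qed.

Lemma altsign_eq0 i : (altsign i == 0) = (i == 0%N).
Proof. by rewrite /altsign; case: (i == 0%N); rewrite ?eqxx ?signr_eq0. Qed.

Lemma altsign_sum v : odd v -> \sum_(j < v) altsign j = 0.
Proof.
move=> ov; rewrite -(big_mkord predT) (_ : v = (v./2).*2.+1); last first.
  by rewrite -[LHS]odd_double_half ov.
elim: (v./2) => [|n IH]; first by rewrite big_nat1.
rewrite doubleS big_nat_recr //= big_nat_recr //= IH add0r /altsign /= !exprS.
by rewrite !mulN1r opprK addNr.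
Qed.

Section Spread.
Variables (K : finFieldType) (psi : K -> int) (L : K -> nat) (v s : nat) (g : K) (z0 : algC).
Hypothesis K2 : exponent2 K.
Hypothesis psi_char : is_char psi.
Hypothesis psi_ntriv : exists a, psi a != 1.
Hypothesis LM : forall x y, x != 0 -> y != 0 -> (L (x * y)%R = L x + L y %[mod v])%N.
Hypothesis g0 : g != 0.
Hypothesis Lg : (L g = 1 %[mod v])%N.
Hypothesis vodd : odd v.
Hypothesis s0 : (0 < s)%N.
Hypothesis z0v : v.-primitive_root z0.

Let v0 : (0 < v)%N. Proof. exact: odd_gt0. Qed.
Let z0c_v c : (z0 ^+ c) ^+ v = 1.
Proof. by rewrite exprAC (prim_expr_order z0v) expr1n. Qed.

Definition fourier (c : nat) : algC :=
  v%:R^-1 * \sum_(j < v) (altsign j)%:~R * ((z0 ^+ c) ^+ j)^*.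

(** The zero mean removes the trivial multiplicative character, to which [gauss_twist] does not
    apply. *)
Lemma fourier0 : fourier 0 = 0.
Proof.
rewrite /fourier (_ : \sum_(j < v) _ = (\sum_(j < v) altsign j)%:~R); last first.
  by rewrite rmorph_sum /=; apply: eq_bigr => j _; rewrite expr0 expr1n conjC1 mulr1.
by rewrite altsign_sum // mulr0.
Qed.

Lemma fourier_le1 c : `|fourier c| <= 1.
Proof.
have vC : 0 < v%:R :> algC by rewrite ltr0n.
rewrite /fourier normrM ger0_norm ?invr_ge0 ?ler0n // mulrC ler_pdivrMr // mul1r.
rewrite (le_trans (ler_norm_sum _ _ _)) // -[v in v%:R]card_ord -sumr_const ler_sum // => j _.
rewrite normrM norm_conjC normrX (unity_root_norm v0 (z0c_v c)) expr1n mulr1.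
by rewrite -intr_norm -[1]/(1%:~R) ler_int altsign_le1.
Qed.

Lemma fourier_inv i : (i < v)%N -> (altsign i)%:~R = \sum_(c < v) fourier c * (z0 ^+ c) ^+ i.
Proof.
move=> iv; rewrite /fourier.
have vN : v%:R != 0 :> algC by rewrite pnatr_eq0 -lt0n.
apply: (mulfI vN); rewrite mulr_sumr.
transitivity (\sum_(c < v) \sum_(j < v) (altsign j)%:~R * (z0 ^+ i * (z0 ^+ j)^*) ^+ c); last first.
  apply: eq_bigr => c _; rewrite -!mulrA mulVKf // mulr_suml; apply: eq_bigr => j _.
  by rewrite exprMn -rmorphXn /= -!exprM -mulrA; congr (_ * _); rewrite mulrC !(mulnC c).
rewrite exchange_big (bigD1 (Ordinal iv)) //= [X in _ + X]big1 => [|j ji].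
  rewrite addr0 -mulr_sumr mulrC; congr (_ * _).
  rewrite -normCK normrX (unity_root_norm v0 (z := z0)) ?expr1n ?(prim_expr_order z0v) //.
  by under eq_bigr => c _ do rewrite expr1n; rewrite sumr_const card_ord.
rewrite -mulr_sumr; set u := z0 ^+ i * (z0 ^+ j)^*.
have u1 : u != 1.
  apply: contra ji => /eqP u1; rewrite -val_eqE /=.
  have : z0 ^+ j == z0 ^+ i.
    rewrite eq_sym -[z0 ^+ j]mul1r -u1 /u -mulrA [_^* * _]mulrC -normCK normrX.
    by rewrite (unity_root_norm v0 (z := z0)) ?expr1n ?mulr1 ?(prim_expr_order z0v).
  by rewrite (eq_prim_root_expr z0v) !modn_small.
have uv : u ^+ v = 1.
  by rewrite /u exprMn -rmorphXn /= ![_ ^+ _ ^+ v]exprAC (prim_expr_order z0v) !expr1n conjC1 mulr1.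
have /eqP : (u - 1) * (\sum_(c < v) u ^+ c) = 0 by rewrite -subrX1 uv subrr.
by rewrite mulf_eq0 subr_eq0 (negbTE u1) /= => /eqP ->; rewrite mulr0.
Qed.

(* A sign depending only on the class of \prod_l x_l in the quotient of order v
   of K^*; the zeros are the points with a zero coordinate and one class. *)
Definition spread (x : 'rV[K]_s) : int :=
  if [exists l : 'I_s, x 0 l == 0] then 0 else altsign ((\sum_l L (x 0%R l)) %% v).

Lemma spread_fourier x : (spread x)%:~R = \sum_(c < v) fourier c * \prod_l mult_char L (z0 ^+ c) (x 0 l).
Proof.
rewrite /spread; case: ifPn => [/existsP[l xl]|].
  by rewrite big1 // => c _; rewrite (bigD1 l) //= /mult_char xl mul0r mulr0.
rewrite negb_exists => /forallP xN.
rewrite fourier_inv ?ltn_pmod //; apply: eq_bigr => c _; congr (_ * _).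
rewrite (expr_mod _ (z0c_v c)) -prodrXr; apply: eq_bigr => l _.
by rewrite /mult_char (negbTE (xN l)).
Qed.

Definition pair_rV (b x : 'rV[K]_s) : int := \prod_l psi (b 0 l * x 0 l).

Lemma exponent2_rV_field : exponent2 'rV[K]_s.
Proof. by move=> x; apply/rowP => i; rewrite !mxE K2. Qed.

Lemma pair_rV_char b : is_char (pair_rV b).
Proof.
split=> [|x y]; first by rewrite /pair_rV big1 // => l _; rewrite mxE mulr0 psi_char.1.
rewrite /pair_rV -big_split /=; apply: eq_bigr => l _.
by rewrite mxE mulrDr psi_char.2.
Qed.

Lemma pair_rVC b x : pair_rV b x = pair_rV x b.
Proof. by apply: eq_bigr => l _; rewrite mulrC. Qed.

Lemma pair_rV_pairing : dual_pairing pair_rV.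
Proof.
split; [exact: pair_rV_char | exact: pair_rVC |] => x x0.
under eq_bigr => b _ do rewrite pair_rVC.
have [i xi] : exists i, x 0 i != 0.
  apply/existsP; apply: contraNT x0; rewrite negb_exists => /forallP h.
  by apply/eqP/rowP => i; rewrite !mxE; apply/eqP; rewrite -[_ == _]negbK; apply: h.
have [a ha] := psi_ntriv.
apply: (@char_sum _ _ ((a / x 0 i) *: delta_mx 0 i) (pair_rV_char x)).
rewrite /pair_rV (bigD1 i) //= big1 => [|j ji]; last first.
  by rewrite !mxE (negbTE ji) andbF !mulr0 psi_char.1.
by rewrite !mxE !eqxx !mulr1 mulrC divfK.
Qed.

Lemma sum_rV_prod (F : 'I_s -> K -> algC) :
  \sum_(x : 'rV[K]_s) \prod_l F l (x 0 l) = \prod_l \sum_y F l y.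
Proof.
rewrite bigA_distr_bigA /= (reindex (fun h : {ffun 'I_s -> K} => \row_l h l)) /=.
  by apply: eq_bigr => h _; apply: eq_bigr => l _; rewrite mxE.
exists (fun x : 'rV[K]_s => [ffun l => x 0 l]) => [h _|x _].
  by apply/ffunP => l; rewrite ffunE mxE.
by apply/rowP => l; rewrite mxE ffunE.
Qed.

(** Multiplicative and additive characters are both products over the coordinates, so each Fourier
    term becomes a product of [s] twisted Gauss sums. *)
Lemma spread_transform b : (\sum_x spread x * pair_rV b x)%:~R =
  \sum_(c < v) fourier c * gauss psi L (z0 ^+ c) ^+ s * \prod_l (mult_char L (z0 ^+ c) (b 0 l))^*.
Proof.
rewrite rmorph_sum /=.
transitivity (\sum_(x : 'rV[K]_s) \sum_(c < v) fourier c *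
    \prod_l (mult_char L (z0 ^+ c) (x 0 l) * (psi (b 0 l * x 0 l))%:~R)).
  apply: eq_bigr => x _; rewrite rmorphM /= spread_fourier mulr_suml.
  apply: eq_bigr => c _; rewrite -mulrA; congr (_ * _).
  by rewrite rmorph_prod -big_split.
rewrite exchange_big /=; apply: eq_bigr => c _; rewrite -mulr_sumr -mulrA.
have [->|cN] := eqVneq (c : nat) 0%N; first by rewrite fourier0 !mul0r.
congr (_ * _); rewrite (sum_rV_prod (fun l y => mult_char L (z0 ^+ c) y * (psi (b 0 l * y))%:~R)).
transitivity (\prod_(l < s) ((mult_char L (z0 ^+ c) (b 0 l))^* * gauss psi L (z0 ^+ c))).
  apply: eq_bigr => l _; apply: (gauss_twist psi_char LM g0 Lg v0 (z0c_v c)).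
  apply: contra cN => /eqP zc; have := eq_prim_root_expr z0v c 0.
  by rewrite zc expr0 eqxx mod0n modn_small // => /esym.
by rewrite big_split /= prodr_const card_ord mulrC.
Qed.

(** This is the transform at [b = 0], where every product contains the value of [mult_char] at 0. *)
Lemma spread_sum : \sum_x spread x = 0.
Proof.
apply: (@intr_inj algC).
transitivity ((\sum_x spread x * pair_rV 0 x)%:~R : algC).
  congr (_%:~R); apply: eq_bigr => x _.
  by rewrite pair_rVC (pair_rV_char x).1 mulr1.
rewrite spread_transform big1 // => c _.
by rewrite (bigD1 (Ordinal s0)) //= /mult_char mxE eqxx conjC0 mul0r mulr0.
Qed.

(** If all the powers of Gauss sums equalled [sigma * rho], Fourier inversion would give
    [sigma * rho] times [spread] at the coordinatewise inverse of [b]. The [v] deviations add at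
    most [d * rho] each. *)
Lemma spread_flat (sigma rho d : algC) b :
  `|sigma| = 1 -> 0 <= rho -> 0 <= d ->
  (forall z, z ^+ v = 1 -> z != 1 -> `|gauss psi L z ^+ s - sigma * rho| <= d * rho) ->
  `|\sum_x spread x * pair_rV b x|%:~R <= (1 + v%:R * d) * rho.
Proof.
move=> sg1 rho0 d0 hG; rewrite intr_norm spread_transform.
pose S := (spread (\row_l (b 0 l)^-1))%:~R : algC.
have SE : S = \sum_(c < v) fourier c * \prod_l (mult_char L (z0 ^+ c) (b 0 l))^*.
  rewrite /S spread_fourier; apply: eq_bigr => c _; congr (_ * _).
  apply: eq_bigr => l _; rewrite mxE; have [->|bl] := eqVneq (b 0 l) 0.
    by rewrite invr0 /mult_char eqxx conjC0.
  by rewrite (mult_char_inv LM v0 (z0c_v c)).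
have S1 : `|S| <= 1.
  rewrite /S -intr_norm -[1]/(1%:~R) ler_int /spread.
  by case: ifP => // _; apply: altsign_le1.
rewrite -[X in `|X|](subrK (sigma * rho * S)) (le_trans (ler_normD _ _)) // mulrDl mul1r addrC.
apply: lerD.
  by rewrite !normrM sg1 mul1r (ger0_norm rho0) ler_piMr.
rewrite SE mulr_sumr -sumrB (le_trans (ler_norm_sum _ _ _)) //.
rewrite -mulrA -[v in v%:R]card_ord mulr_natl -sumr_const ler_sum // => c _.
have [->|cN] := eqVneq (c : nat) 0%N.
  by rewrite fourier0 !mul0r mulr0 subrr normr0 mulr_ge0.
rewrite (_ : _ - _ = fourier c * ((gauss psi L (z0 ^+ c) ^+ s - sigma * rho) *
    \prod_l (mult_char L (z0 ^+ c) (b 0 l))^*)); last by ring.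
rewrite normrM -[X in _ <= X]mul1r ler_pM ?fourier_le1 // normrM -[X in _ <= X]mulr1.
rewrite ler_pM //; first apply: hG => //.
  apply: contra cN => /eqP zc; have := eq_prim_root_expr z0v c 0.
  by rewrite zc expr0 eqxx mod0n modn_small // => /esym.
rewrite normr_prod; apply: prodr_ile1 => l _; rewrite normr_ge0 /=.
rewrite norm_conjC /mult_char; case: eqP => _; first by rewrite normr0 ler01.
by rewrite normrX (unity_root_norm v0 (z0c_v c)) expr1n.
Qed.

Let D0 := [set x : 'rV[K]_s | [exists l : 'I_s, x 0 l == 0]].
Let D1 := [set x : 'rV[K]_s | [forall l : 'I_s, x 0%R l != 0%R] & (\sum_l L (x 0%R l)) %% v == 0]%N.

Lemma spread_zeros : [set x | spread x == 0] = D0 :|: D1.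
Proof.
apply/setP => x; rewrite !inE /spread; case: ifPn => [//|]; rewrite ?eqxx //.
by rewrite negb_exists altsign_eq0 => ->.
Qed.

(* Change an arbitrary zero coordinate to an arbitrary value. *)
Lemma card_spread_coord0 : (#|K| * #|D0| <= s * #|{: 'rV[K]_s}|)%N.
Proof.
pose l0 := Ordinal s0.
pose lx (x : 'rV[K]_s) := odflt l0 [pick l | x 0 l == 0].
have lxP (x : 'rV[K]_s) : [exists l : 'I_s, x 0 l == 0] -> x 0 (lx x) = 0.
  move=> /existsP[l xl]; rewrite /lx; case: pickP => [l' /eqP //|no].
  by have := no l; rewrite xl.
pose h (p : K * 'rV[K]_s) := (lx p.2, p.2 + p.1 *: delta_mx 0 (lx p.2)).
rewrite -[X in (_ <= X * _)%N](card_ord s) -card_prod -[#|K|]cardsT -cardsX.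
rewrite -(card_in_imset (f := h)) ?max_card // => -[a x] [a' x'].
rewrite !inE /= => xD x'D [el ex].
have x'0 := lxP _ x'D; rewrite -el in x'0 ex.
have ea : a = a'.
  have := congr1 (fun y : 'rV[K]_s => y 0 (lx x)) ex.
  by rewrite !mxE !eqxx !mulr1 x'0 (lxP _ xD) !add0r.
by move: ex; rewrite ea => /addIr ->.
Qed.

(* The multiples of one coordinate by powers of [g] have different classes. *)
Lemma card_spread_class0 : (v * #|D1| <= #|{: 'rV[K]_s}|)%N.
Proof.
pose l0 := Ordinal s0.
pose h (p : 'I_v * 'rV[K]_s) : 'rV[K]_s :=
  \row_l (if l == l0 then g ^+ p.1 * p.2 0 l else p.2 0 l).
have Lgn i y : y != 0 -> (L (g ^+ i * y)%R = i + L y %[mod v])%N.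
  move=> y0; elim: i => [|i IH]; first by rewrite mul1r.
  rewrite exprS -mulrA LM ?mulf_neq0 ?expf_neq0 // -modnDm Lg IH modnDm.
  by rewrite !addSn add0n.
have hL i (x : 'rV[K]_s) : [forall l : 'I_s, x 0%R l != 0%R] ->
    (\sum_l L (h (i, x) 0%R l) = i + \sum_l L (x 0%R l) %[mod v])%N.
  move=> /forallP xN; rewrite (bigD1 l0) // [in RHS](bigD1 l0) //= mxE eqxx addnA.
  rewrite (eq_bigr (fun l => L (x 0%R l))) => [|l ll]; last by rewrite mxE (negbTE ll).
  by rewrite -modnDml Lgn // modnDml.
rewrite -[v in (v * _)%N](card_ord v) -[#|'I_v|]cardsT -cardsX.
rewrite -(card_in_imset (f := h)) ?max_card // => -[i x] [j y].
rewrite !inE /= => /andP[xN /eqP xL] /andP[yN /eqP yL] e.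
have ij : i = j.
  have := hL i x xN; rewrite e hL // -modnDmr yL -[RHS]modnDmr xL !addn0.
  by rewrite !modn_small // => ij; apply: val_inj.
rewrite ij in e *; congr pair; apply/rowP => l.
have := congr1 (fun y : 'rV[K]_s => y 0 l) e; rewrite !mxE; case: eqP => // _.
by apply: mulfI; rewrite expf_neq0.
Qed.

End Spread.

Lemma dvdn_pow7 m r : (7 ^ m %| (2 ^ (3 * (7 ^ m * r))).-1)%N.
Proof.
have h8 : (2 ^ (3 * 7 ^ m) = 1 %[mod 7 ^ m])%N.
  have [k hk] := pow8_pow7 m; apply/eqP.
  rewrite -eqz_nat -!modz_nat; apply/eqP.
  rewrite expnM -[(2 ^ 3)%N]/8%N -[(8 ^ _)%N%:Z]natz natrX hk -[(7 ^ m)%N%:Z]natz natrX.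
  rewrite exprS (_ : 7 * _ * _ = (7 * (1 + 7 * k)) * 7 ^+ m); last by ring.
  by rewrite addrC modzMDl.
rewrite -subn1 -eqn_mod_dvd ?expn_gt0 // mulnA expnM -modnXm h8 modnXm exp1n.
by rewrite eqxx.
Qed.

(** The bound is squared and cleared of denominators because it is proved over [algC] and used over
    a real field. *)
Lemma flat_partial_odd (D : nat) : (0 < D)%N ->
  exists (V : finZmodType) (n : nat) (f : V -> int),
  [/\ exponent2 V, odd n, #|V| = (2 ^ n)%N, forall x, f x != 0 -> `|f x| = 1 & \sum_x f x = 0]
  /\ [/\ (0 < #|[set x | f x == 0%R]|)%N, (D * #|[set x | f x == 0%R]| <= #|V|)%N
    & forall e, is_char e ->
      (D%:Z * `|\sum_x f x * e x|) ^+ 2 <= D.+1%:Z ^+ 2 * 2 ^+ n].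
Proof.
(* Makes [v >= 2 * D], so that the vanishing class has at most [1 / (2 * D)] of the points. *)
move=> D0; pose m := (2 * D)%N; set v := (7 ^ m)%N.
have v0 : (0 < v)%N by rewrite expn_gt0.
have vodd : odd v by rewrite oddX orbT.
have Dv : (2 * D <= v)%N by rewrite ltnW // ltn_expl.
(* Chosen before the field: with [k] as below, the total error [v * (3 * k) / (A * j.+1)] is at most
   [1 / D]. *)
pose A := (2 * v * (3 * v) * D)%N.
have A0 : (0 < A)%N by rewrite /A !muln_gt0 v0 D0.
have [s [j [bb [sodd Asj hw]]]] := odd_power_near_sign w7_norm w7_nontorsion A0.
have s0 : (0 < s)%N by apply: odd_gt0.
(* A multiple of [v], for [v] to divide [2 ^ (3 * k) - 1], and odd, for the dimension to be odd. *)
pose k := (v * (2 * j + 1))%N.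
have kodd : odd k by rewrite oddM vodd oddD mul2n odd_double.
have k0 : (0 < 3 * k)%N by rewrite muln_gt0 /= odd_gt0.
have [K [psi [cK K2 psi_char psi_sqr psi_ntriv]]] := finField2_char k0.
have vK : (v %| #|K|.-1)%N by rewrite cK dvdn_pow7.
have [L [LM' [g g0 Lg']]] := finField_log K.
have LM x y : x != 0 -> y != 0 -> (L (x * y)%R = L x + L y %[mod v])%N.
  by move=> x0 y0; rewrite -(modn_dvdm _ vK) LM' // modn_dvdm.
have Lg : (L g = 1 %[mod v])%N by rewrite -(modn_dvdm _ vK) Lg' modn_dvdm.
have [z0 z0v] := C_prim_root_exists v0.
pose rho : algC := sqrtC 2 ^+ (3 * k * s).
have rho0 : 0 <= rho by rewrite exprn_ge0 // ltW // sqrtC2_gt0.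
move Etau : ((-1) ^+ bb : algC) hw => tau hw.
have tau1 : `|tau| = 1 by rewrite -Etau normr_sign.
pose d : algC := (3 * k)%:R * (A * j.+1)%:R^-1.
have hG z : z ^+ v = 1 -> z != 1 -> `|gauss psi L z ^+ s - (- tau) * rho| <= d * rho.
  move=> zv z1; have [a [b [ab ->]]] := gauss_pow7 K2 psi_char psi_sqr psi_ntriv LM g0 Lg cK zv z1.
  have piE : pi7 = w7 * sqrtC 2 by rewrite divfK // gt_eqF // sqrtC2_gt0.
  have r2 : (sqrtC 2)^* = sqrtC 2 :> algC by rewrite conj_Creal // gtr0_real // sqrtC2_gt0.
  have -> : - (pi7 ^+ a * (pi7^*) ^+ b) = - (w7 ^+ a * (w7^*) ^+ b * sqrtC 2 ^+ (3 * k)).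
    by rewrite -ab exprD piE rmorphM /= r2 !exprMn; congr (- _); ring.
  have wc1 : `|w7^*| = 1 by rewrite norm_conjC w7_norm.
  (* [s] odd keeps the minus sign, and [3 * k] odd turns [tau ^+ a * tau ^+ b] into [tau], so the
     target does not depend on [a] and [b]. *)
  have -> : (- (w7 ^+ a * (w7^*) ^+ b * sqrtC 2 ^+ (3 * k))) ^+ s - (- tau) * rho
     = - ((w7 ^+ s) ^+ a * ((w7^*) ^+ s) ^+ b - tau ^+ a * tau ^+ b) * rho.
    rewrite exprNn -signr_odd sodd expr1 !exprMn -!exprM -/rho.
    rewrite (mulnC s a) (mulnC s b) -(exprD tau) ab.
    rewrite (_ : tau ^+ (3 * k) = tau); first by ring.
    have k3 : odd (3 * k) by rewrite oddM kodd.
    by rewrite -Etau; case: (bb); rewrite ?expr0 ?expr1n // expr1 -signr_odd k3.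
  rewrite normrM normrN (ger0_norm rho0) ler_wpM2r //.
  rewrite (le_trans (near_mul _ _ _ _)) ?normrX ?wc1 ?tau1 ?expr1n //.
  rewrite (le_trans (lerD (near_exp a _ tau1) (near_exp b _ tau1))) ?normrX ?w7_norm ?wc1 ?expr1n //.
  have -> : `|w7^* ^+ s - tau| = `|w7 ^+ s - tau|.
    rewrite -norm_conjC rmorphB rmorphXn /= conjCK.
    by rewrite -Etau [(_ ^+ bb)^*]conj_Creal // rpredX // rpredN rpred1.
  by rewrite -mulrDl -natrD ab ler_wpM2l ?ler0n.
have d0 : 0 <= d by rewrite mulr_ge0 ?invr_ge0 ?ler0n.
have vd : v%:R * d <= D%:R^-1.
  have Aj : (0 < A * j.+1)%N by rewrite muln_gt0 A0.
  rewrite /d mulrA -natrM ler_pdivrMr ?ltr0n // mulrC ler_pdivlMr ?ltr0n //.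
  rewrite -natrM ler_nat (_ : v * (3 * k) * D = (3 * v * v * D) * (2 * j + 1))%N; last by rewrite /k; ring.
  rewrite (_ : A * j.+1 = (3 * v * v * D) * (2 * j + 2))%N; last by rewrite /A -[j.+1]addn1; ring.
  by rewrite leq_mul2l leq_add2l orbT.
pose f := spread L v (s := s).
have cV : #|{: 'rV[K]_s}| = (2 ^ (3 * k * s))%N by rewrite card_mx mul1n cK -expnM.
exists 'rV[K]_s, (3 * k * s)%N, f; split.
  split=> //; first exact: exponent2_rV_field.
  - by rewrite oddM sodd oddM kodd.
  - move=> x; rewrite /f /spread; case: ifP; rewrite ?eqxx // => _; exact: altsign_abs.
  - by apply: (@spread_sum K psi L v s g z0).
split.
- apply/card_gt0P; exists 0; rewrite inE /f /spread.
  case: ifPn => // /existsPn h; have := h (Ordinal s0); by rewrite mxE eqxx.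
- rewrite spread_zeros; set B0 := [set _ | _]; set B1 := [set _ | _].
  have h0 : (#|K| * #|B0| <= s * #|{: 'rV[K]_s}|)%N by apply: card_spread_coord0.
  have h1 : (v * #|B1| <= #|{: 'rV[K]_s}|)%N by apply: (@card_spread_class0 K L v s g).
  have hU : (#|B0 :|: B1| <= #|B0| + #|B1|)%N by rewrite cardsU leq_subr.
  (* [s / #|K|] bounds the share of points with a zero coordinate, and [Asj] makes it at most
     [1 / (2 * D)]. *)
  have hq : (2 * D * s <= #|K|)%N.
    apply: (leq_trans (n := (A * s)%N)).
      rewrite leq_mul2r; apply/orP; right.
      rewrite (_ : A = (2 * D) * (3 * v * v))%N; last by rewrite /A; ring.
      by rewrite leq_pmulr // !muln_gt0 v0.
    rewrite (leq_trans Asj) // cK leq_exp2l // /k.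
    rewrite (leq_trans (n := (3 * (1 * (2 * j + 1)))%N)) //; first by clear; lia.
    by rewrite leq_mul2l leq_mul2r v0 orbT.
  have h0' : (2 * D * #|B0| <= #|{: 'rV[K]_s}|)%N.
    rewrite -(leq_pmul2l s0) (leq_trans _ h0) // mulnA leq_mul2r; apply/orP; right.
    by rewrite mulnC.
  have h1' : (2 * D * #|B1| <= #|{: 'rV[K]_s}|)%N.
    by rewrite (leq_trans _ h1) // leq_mul2r Dv orbT.
  move: h0' h1' hU; move: #|_| #|_| #|_| #|_| => q a b u; clear; nia.
- move=> e he.
  have [b eb] := dual_pairing_char (@exponent2_rV_field K s K2) (pair_rV_pairing s psi_char psi_ntriv) he.
  have tau1' : `|- tau| = 1 by rewrite normrN.
  have hW := spread_flat psi_char LM g0 Lg vodd z0v b tau1' rho0 d0 hG.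
  rewrite (eq_bigr (fun x => f x * pair_rV psi b x)) => [|x _]; last by rewrite eb.
  set W := `|_| in hW *.
  rewrite -(ler_int algC) !(rmorphM, rmorphXn) /=.
  have DC : 0 < D%:R :> algC by rewrite ltr0n.
  have hDW : D%:R * W%:~R <= D.+1%:R * rho.
    rewrite (le_trans (ler_wpM2l (ltW DC) hW)) // mulrA ler_wpM2r // mulrDr mulr1 -natr1 lerD2l.
    by rewrite mulrC -ler_pdivlMr // mul1r.
  have rho2 : rho ^+ 2 = 2%:~R ^+ (3 * k * s).
    by rewrite /rho exprAC sqrtCK.
  rewrite -rho2 -!expr2 -!exprMn; apply: lerXn2r; rewrite ?nnegrE ?mulr_ge0 ?ler0n ?ler0z ?normr_ge0 //.
Qed.

(** Erasing the row 0 of the bent function alters the transform only at characters trivial in the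
    second variable, where it becomes 0. In particular the sum becomes 0. *)
Lemma flat_partial_even (D : nat) : (0 < D)%N ->
  exists (V : finZmodType) (n : nat) (f : V -> int),
  [/\ exponent2 V, ~~ odd n, #|V| = (2 ^ n)%N, forall x, f x != 0 -> `|f x| = 1 & \sum_x f x = 0]
  /\ [/\ (0 < #|[set x | f x == 0%R]|)%N, (D * #|[set x | f x == 0%R]| <= #|V|)%N
    & forall e, is_char e ->
      (D%:Z * `|\sum_x f x * e x|) ^+ 2 <= D.+1%:Z ^+ 2 * 2 ^+ n].
Proof.
move=> D0; pose V := ('rV['F_2]_D * 'rV['F_2]_D)%type.
pose f (p : V) : int := if p.1 == 0 then 0 else bent p.
have cV : #|{: V}| = (2 ^ D.*2)%N by rewrite card_prod card_mx card_Fp // mul1n -expnD addnn.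
have f1 x : f x != 0 -> `|f x| = 1.
  by rewrite /f; case: ifP => _; rewrite ?eqxx // bent_abs1.
have W (e1 : 'rV['F_2]_D -> int) b :
    \sum_p f p * (e1 p.1 * chi b p.2) = if b == 0 then 0 else e1 b * (2 ^ D)%:R.
  transitivity (\sum_(y | y != 0) e1 y * \sum_z chi y z * chi b z).
    rewrite sum_pairE [RHS]big_mkcond; apply: eq_bigr => y _; rewrite /f /=.
    case: eqP => _ /=; first by rewrite big1 // => z _; rewrite mul0r.
    by rewrite mulr_sumr; apply: eq_bigr => z _; rewrite /bent mulrCA.
  under eq_bigr => y _ do rewrite chi_orthogonal.
  have [->|b0] := eqVneq b 0.
    by rewrite big1 // => y /negbTE ->; rewrite mulr0.
  rewrite (bigD1 b) //= eqxx big1 ?addr0 // => y /andP[_ /negbTE ->].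
  by rewrite mulr0.
have Z : [set x | f x == 0%R] = finset.setX [set 0%R] [set: 'rV['F_2]_D].
  apply/setP => -[y z]; rewrite !inE /f /= andbT.
  case: (y == 0); first by rewrite eqxx.
  by rewrite -normr_eq0 bent_abs1 oner_eq0.
have cZ : #|[set x | f x == 0%R]| = (2 ^ D)%N.
  by rewrite Z cardsX cards1 cardsT card_mx card_Fp // !mul1n.
exists V, D.*2, f; split; split.
- exact: pair_exponent2 (@rV_exponent2 D) (@rV_exponent2 D).
- by rewrite odd_double.
- exact: cV.
- exact: f1.
- have := W (fun=> 1) 0; rewrite eqxx => h; rewrite -[RHS]h.
  by apply: eq_bigr => p _; rewrite (chiC 0) (chi_char _).1 !mulr1.
- by rewrite cZ expn_gt0.
- by rewrite cZ cV -addnn expnD leq_mul2r ltnW ?orbT // ltn_expl.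
- move=> e /char_pair [e1 /char_rV [b eb] eE].
  have -> : \sum_p f p * e p = if b == 0 then 0 else e (b, 0) * (2 ^ D)%:R.
    apply: etrans (W (fun y => e (y, 0)) b).
    by apply: eq_bigr => -[y z] _; rewrite /= eE eb.
  case: (b == 0).
    by rewrite normr0 mulr0 expr0n /= mulr_ge0 // exprn_ge0.
  rewrite normrM (char_abs1 _ (@rV_exponent2 D) e1) mul1r normr_nat exprMn ler_pM //.
  - by rewrite lerXn2r // ?nnegrE // lez_nat.
  - by rewrite natrX -exprM muln2.
Qed.

(** * From partial functions to balanced functions in all large dimensions *)

Lemma flat_balanced_mono (R : rcfType) n (c c' : R) : c <= c' -> flat_balanced n c -> flat_balanced n c'.
Proof.
move=> cc [F [F1 F0 Fc]]; exists F; split=> // e he; apply: le_trans (Fc e he) _.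
by rewrite ler_wpM2r // sqrtr_ge0.
Qed.

(** A share [1 / E ^ 2] of zeros costs [2 / E] when filled, since [2 ^ l] is at most twice the
    square root of their number. The partial function itself exceeds 1 by [1 / E ^ 2 <= 1 / E]. *)
Lemma flat_balanced_partial (R : rcfType) (V : finZmodType) n (f : V -> int) (E : nat) : (0 < E)%N ->
  exponent2 V -> #|V| = (2 ^ n)%N ->
  (forall x, f x != 0 -> `|f x| = 1) -> \sum_x f x = 0 ->
  (0 < #|[set x | f x == 0%R]|)%N -> (E ^ 2 * #|[set x | f x == 0%R]| <= #|V|)%N ->
  (forall e, is_char e ->
     ((E ^ 2)%N%:Z * `|\sum_x f x * e x|) ^+ 2 <= (E ^ 2).+1%:Z ^+ 2 * 2 ^+ n) ->
  exists l, flat_balanced (n + l.*2) (1 + 3 / E%:R : R).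
Proof.
move=> E0 V2 cV f1 f0 Z0 ZE fW; set z := #|_| in Z0 ZE.
have ex : exists l, (z < 4 ^ l)%N by exists z; rewrite ltn_expl.
case: (ex_minnP ex) => l zl lmin; exists l.
(* By minimality of [l]; for [l = 0] because there is at least one zero. *)
have l4 : (4 ^ l <= 4 * z)%N.
  case: l zl lmin => [|l] zl lmin; first by rewrite expn0; lia.
  rewrite expnS leq_mul2l /= leqNgt; apply/negP => h.
  by have := lmin l h; rewrite ltnn.
have EC : 0 < E%:R :> R by rewrite ltr0n.
have S0 : 0 <= Num.sqrt (2 ^+ n : R) by apply: sqrtr_ge0.
have S2 : Num.sqrt (2 ^+ n : R) ^+ 2 = 2 ^+ n by rewrite sqr_sqrtr // exprn_ge0.
apply: (@flat_balanced_mono _ _ (1 + (E%:R ^+ 2)^-1 + 2 / E%:R)).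
  rewrite -addrA lerD2l (_ : 3 / E%:R = E%:R^-1 + 2 / E%:R); last by field; rewrite lt0r_neq0.
  rewrite lerD2r lef_pV2 ?posrE ?exprn_gt0 // expr2 ler_peMl ?ler0n //.
  by rewrite ler1n.
apply: (flat_balanced_fill V2 cV f1 f0 _ zl).
  move=> e he; have := fW e he; set w := `|_|.
  have w0 : 0 <= w by rewrite /w normr_ge0.
  rewrite -(ler_int R) !(rmorphM, rmorphXn) /= => h.
  have -> : 1 + (E%:R ^+ 2)^-1 = (E ^ 2).+1%:R / (E ^ 2)%:R :> R.
    by rewrite -natr1 natrX; field; rewrite lt0r_neq0.
  rewrite mulrAC ler_pdivlMr ?ltr0n ?expn_gt0 ?E0 // mulrC.
  rewrite -(@ler_pXn2r _ 2) ?nnegrE ?mulr_ge0 ?ler0n ?ler0z //.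
  by rewrite [X in _ <= X]exprMn S2 natrX [X in X <= _]expr2 (expr2 E%:R).
rewrite -(@ler_pXn2r _ 2) ?nnegrE ?mulr_ge0 ?ler0n ?invr_ge0 //.
rewrite exprMn S2 expr_div_n mulrAC ler_pdivlMr ?exprn_gt0 //.
rewrite -!natrX -!natrM ler_nat -expnM mulnC (mulnC l) expnM.
rewrite -cV (leq_trans _ (leq_mul (leqnn (2 ^ 2)) ZE)) //.
by rewrite mulnCA leq_mul2l l4 orbT.
Qed.

Lemma flat_balanced_eventually (R : realType) (eps : R) : 0 < eps ->
  exists N, forall n, (N <= n)%N -> flat_balanced n (1 + eps).
Proof.
move=> e0; pose E := (Num.truncn (3 / eps)).+1.
have Ee : 3 / E%:R <= eps.
  rewrite ler_pdivrMr ?ltr0n // mulrC -ler_pdivrMr // ltW //.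
  by apply: truncnS_gt.
have E2 : (0 < E ^ 2)%N by rewrite expn_gt0.
have [V [n0 [f [[V2 n0e cV f1 f0] [Z0 ZE fW]]]]] := flat_partial_even E2.
have [l g0] := @flat_balanced_partial R V n0 f E isT V2 cV f1 f0 Z0 ZE fW.
have [V' [n1 [f' [[V2' n1o cV' f1' f0'] [Z0' ZE' fW']]]]] := flat_partial_odd E2.
have [l' g1] := @flat_balanced_partial R V' n1 f' E isT V2' cV' f1' f0' Z0' ZE' fW'.
have lift n t (c : R) : flat_balanced n c -> flat_balanced (n + t.*2) c.
  by move=> g; elim: t => [|t IH]; rewrite ?addn0 // doubleS !addnS; apply: flat_balancedS2.
exists (n0 + l.*2 + (n1 + l'.*2))%N => n hn.
have [no|ne] := boolP (odd n).
  rewrite (_ : n = (n1 + l'.*2) + ((n - (n1 + l'.*2))./2).*2)%N.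
    by apply: lift; apply: flat_balanced_mono g1; rewrite lerD2l.
  have le : (n1 + l'.*2 <= n)%N by rewrite (leq_trans _ hn) // leq_addl.
  rewrite even_halfK ?subnKC // oddB // oddD odd_double no n1o //.
rewrite (_ : n = (n0 + l.*2) + ((n - (n0 + l.*2))./2).*2)%N.
  by apply: lift; apply: flat_balanced_mono g0; rewrite lerD2l.
have le : (n0 + l.*2 <= n)%N by rewrite (leq_trans _ hn) // leq_addr.
by rewrite even_halfK ?subnKC // oddB // oddD odd_double (negbTE ne) (negbTE n0e).
Qed.

(** * Nonlinearity *)

Lemma sgE (x y : 'F_2) : sg x * sg y = 1 - 2 * (x != y)%:R.
Proof. by case: (F2P x) => ->; case: (F2P y) => ->. Qed.

Lemma sg_inj : injective sg.
Proof. by move=> x y; case: (F2P x) => ->; case: (F2P y) => ->. Qed.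

Lemma hdist_sum n (F G : boolean_fun n) :
  \sum_y sg (F y) * sg (G y) = 2 ^+ n - 2 * (hdist F G)%:Z.
Proof.
under eq_bigr => y _ do rewrite sgE.
rewrite sumrB sumr_const card_mx card_Fp // mul1n -mulr_sumr natrX; congr (_ - _ * _).
rewrite /hdist -sum1_card -natz natr_sum [RHS]big_mkcond /=.
by apply: eq_bigr => y _; rewrite inE; case: (F y != G y).
Qed.

Lemma affineP n (G : boolean_fun n) : reflect
  (exists a b, forall y, sg (G y) = sg b * chi a y) (affine G).
Proof.
apply: (iffP existsP) => [[a /existsP[b /forallP h]]|[a [b h]]]; exists a.
  by exists b => y; rewrite (eqP (h y)) sgD mulrC.
apply/existsP; exists b; apply/forallP => y; apply/eqP.
by apply: sg_inj; rewrite h mulrC -sgD.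
Qed.

Lemma nonlinearity_le n (F G : boolean_fun n) : affine G -> (nonlinearity F <= hdist F G)%N.
Proof.
move=> aG; rewrite /nonlinearity; have := mem_index_enum G.
elim: (index_enum _) => // G' s IH.
rewrite inE big_cons => /orP[/eqP <-|/IH h]; first by rewrite aG geq_minl.
by case: ifP => // _; rewrite (leq_trans (geq_minr _ _)).
Qed.

Lemma nonlinearity_lower (R : rcfType) n (F : boolean_fun n) (B : R) : 0 <= B ->
  flat (fun y => sg (F y)) B -> 2 ^+ n - B <= 2 * (nonlinearity F)%:R.
Proof.
move=> B0 FB; rewrite /nonlinearity.
apply: (big_ind (fun r => 2 ^+ n - B <= 2 * r%:R)) => [|x y hx hy|G /affineP[a [b aG]]].
(* The default [2 ^ n] of the minimum also satisfies the bound. *)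
- rewrite natrX lerBlDr mulr_natl mulr2n -addrA lerDl addr_ge0 // exprn_ge0 //.
- by rewrite /minn; case: ifP.
- have := hdist_sum F G.
  rewrite (eq_bigr (fun y => sg b * (sg (F y) * chi a y))) => [|y _]; last by rewrite aG mulrCA.
  rewrite -mulr_sumr => h; rewrite lerBlDr -lerBlDl.
  apply: le_trans (FB _ (chi_char a)).
  have -> : 2 ^+ n - 2 * (hdist F G)%:R = (2 ^+ n - 2 * (hdist F G)%:Z)%:~R :> R.
    by rewrite rmorphB rmorphM rmorphXn.
  rewrite -h ler_int (le_trans (ler_norm _)) // normrM.
  by case: (F2P b) => ->; rewrite ?normrN normr1 mul1r.
Qed.

Lemma rho'_ge (R : rcfType) n (c : R) : 0 <= c -> flat_balanced n c ->
  2 ^+ n - c * Num.sqrt (2 ^+ n) <= 2 * (rho' n)%:R.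
Proof.
move=> c0 [f [f1 f0 fc]].
pose F : boolean_fun n := [ffun y => if f y == 1 then 0 else 1].
have FE y : sg (F y) = f y.
  rewrite ffunE; have := f1 y; case: eqP => [->//|h h1].
  by have := normr_idP _; move: h h1; case: (f y) => [[|[|k]]|[|k]].
have bF : balanced F.
  have : \sum_y sg (F y) = 0 by rewrite -[RHS]f0; apply: eq_bigr => y _; rewrite FE.
  rewrite (bigID (fun y => F y == 0)) /=.
  rewrite (eq_bigr (fun=> 1)) => [|y /eqP -> //].
  rewrite [X in _ + X](eq_bigr (fun=> -1)) => [|y]; last by case: (F2P (F y)) => ->.
  rewrite !sumr_const mulNrn => /eqP; rewrite subr_eq0 !natz eqz_nat /balanced => /eqP h.
  apply/eqP; rewrite !cardsE; apply: etrans (etrans h _); apply: eq_card => y //.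
  by rewrite !unfold_in /=; case: (F2P (F y)) => ->.
apply: (le_trans (y := 2 * (nonlinearity F)%:R)).
  apply: nonlinearity_lower; first by rewrite mulr_ge0 ?sqrtr_ge0.
  move=> e he; have := fc e he.
  by under [in X in _ -> X]eq_bigr => y _ do rewrite FE.
by rewrite ler_wpM2l // ler_nat; apply: leq_bigmax_cond bF.
Qed.

(** By Parseval some coefficient satisfies [2 ^+ n <= W a ^+ 2], and the affine function with linear
    part [a] and suitable constant is then close to [F]. *)
Lemma nonlinearity_upper (R : rcfType) n (F : boolean_fun n) :
  2 * (nonlinearity F)%:R <= 2 ^+ n - Num.sqrt (2 ^+ n) :> R.
Proof.
pose W a := \sum_y sg (F y) * chi a y.
have sg2 x : sg x * sg x = 1 by case: (F2P x) => ->.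
have parseval : \sum_a W a ^+ 2 = 2 ^+ n * 2 ^+ n.
  transitivity (\sum_a \sum_x \sum_y sg (F x) * sg (F y) * chi a (x + y)).
    apply: eq_bigr => a _; rewrite expr2 mulr_suml; apply: eq_bigr => x _.
    by rewrite mulr_sumr; apply: eq_bigr => y _; rewrite mulrACA (chi_char a).2.
  rewrite exchange_big /=.
  rewrite (eq_bigr (fun=> 2 ^+ n)) => [|x _].
    by rewrite sumr_const card_mx card_Fp // mul1n -[LHS]mulr_natl natrX.
  rewrite exchange_big (bigD1 x) //= [X in _ + X]big1 => [|y yx].
    by rewrite addr0 -mulr_sumr chi_sum rV_exponent2 eqxx sg2 mul1r natrX.
  rewrite -mulr_sumr chi_sum -(inj_eq (addIr y)) add0r -addrA rV_exponent2 addr0.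
  by rewrite eq_sym (negbTE yx) mulr0.
have [a Wa] : exists a, 2 ^+ n <= W a ^+ 2.
  apply/existsP; apply: contraT; rewrite negb_exists => /forallP h.
  have : \sum_a W a ^+ 2 < \sum_(a : 'rV['F_2]_n) 2 ^+ n.
    apply: ltr_sum => [|a _]; last by rewrite ltNge h.
    by apply/hasP; exists 0; rewrite ?mem_index_enum.
  by rewrite parseval sumr_const card_mx card_Fp // mul1n -[X in _ < X]mulr_natl natrX ltxx.
(* The constant term makes the correlation of [F] and [G] equal to [|W a|]. *)
pose b : 'F_2 := if 0 <= W a then 0 else 1.
pose G : boolean_fun n := [ffun y => dot a y + b].
have aG : affine G.
  by apply/existsP; exists a; apply/existsP; exists b; apply/forallP => y; rewrite ffunE.
have WE : `|W a| = 2 ^+ n - 2 * (hdist F G)%:Z.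
  rewrite -hdist_sum (eq_bigr (fun y => sg b * (sg (F y) * chi a y))) => [|y _].
    rewrite -mulr_sumr -/(W a) /b; case: (lerP 0 (W a)) => h; first by rewrite mul1r ger0_norm.
    by rewrite mulN1r ltr0_norm.
  by rewrite ffunE sgD mulrA mulrC.
apply: (le_trans (y := 2 * (hdist F G)%:R)).
  by rewrite ler_wpM2l // ler_nat nonlinearity_le.
rewrite lerBrDr addrC -lerBrDr.
have -> : 2 ^+ n - 2 * (hdist F G)%:R = `|W a|%:~R :> R.
  by rewrite WE rmorphB rmorphM rmorphXn.
rewrite -(@ler_pXn2r _ 2) ?nnegrE ?sqrtr_ge0 ?ler0z // sqr_sqrtr ?exprn_ge0 //.
have : (2 ^+ n : int) <= `|W a| ^+ 2 by rewrite -normrX ger0_norm ?sqr_ge0.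
by rewrite -(ler_int R) !rmorphXn.
Qed.

Lemma rho'_le (R : rcfType) n : 2 * (rho' n)%:R <= 2 ^+ n - Num.sqrt (2 ^+ n) :> R.
Proof.
rewrite /rho'; apply: (big_ind (fun r => 2 * r%:R <= 2 ^+ n - Num.sqrt (2 ^+ n) :> R)).
(* The starting value 0 of the maximum. *)
- rewrite mulr0 subr_ge0 -[X in _ <= X]sqr_sqrtr ?exprn_ge0 // expr2 ler_peMl ?sqrtr_ge0 //.
  by rewrite -[X in X <= _]sqrtr1 ler_wsqrtr // exprn_ege1 // ler1n.
- by move=> x y hx hy; rewrite /maxn; case: ifP.
- by move=> F _; apply: nonlinearity_upper.
Qed.

Lemma mu'E (R : realType) n :
  mu' R n = Num.sqrt (2 ^+ n) - 2 * (rho' n)%:R / Num.sqrt (2 ^+ n).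
Proof.
have S0 : 0 < Num.sqrt (2 ^+ n : R) by rewrite sqrtr_gt0 exprn_gt0.
have hS : 2 `^ (n%:R / 2) = Num.sqrt (2 ^+ n) :> R.
  by rewrite powRrM powR_mulrn // powR12_sqrt // exprn_ge0.
have h1 : 2 `^ (n%:R / 2 - 1) = Num.sqrt (2 ^+ n) / 2 :> R.
  by rewrite powRB ?hS ?powRr1 // ; apply/implyP => _; rewrite pnatr_eq0.
by rewrite /mu' hS h1 invf_div mulrCA mulrA.
Qed.

(** * The limit *)

Local Open Scope classical_set_scope.

Theorem theorem1p2 (R : realType) : mu' R n @[n --> \oo] --> (1 : R).
Proof.
apply/cvgrPdist_le => e e0.
have [N hN] := flat_balanced_eventually e0.
exists N => // n /= Nn.
have S0 : 0 < Num.sqrt (2 ^+ n : R) by rewrite sqrtr_gt0 exprn_gt0.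
have S2 : 2 ^+ n = Num.sqrt (2 ^+ n) * Num.sqrt (2 ^+ n) :> R.
  by rewrite -expr2 sqr_sqrtr // exprn_ge0.
have e1 : 0 <= 1 + e by rewrite addr_ge0 // ltW.
have lo := @rho'_le R n; have hi := rho'_ge e1 (hN n Nn).
rewrite mu'E; move: S0 S2 lo hi; set S := Num.sqrt _; set r := 2 * _ => S0 S2 lo hi.
(* For [S - r / S], Parseval gives the lower bound 1 and the construction the upper bound
   [1 + e]. *)
have lo' : r / S <= S - 1 by rewrite ler_pdivrMr // mulrBl mul1r -S2.
have hi' : S - (1 + e) <= r / S by rewrite ler_pdivlMr // mulrBl -S2.
by rewrite ler_norml; apply/andP; split; lra.
Qed.
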